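(* Let $0<k<m<n$ and suppose that $m-k$ does not divide $n-m$. Then $\mathbb C[\mathfrak q^*]^Q$ is not a polynomial ring, where $\mathfrak q=\mathfrak{sl}_n\ltimes(m(\mathbb C^n)^*\oplus k\mathbb C^n)$. *)

(* Defs.v *)
From HB Require Import structures.
From mathcomp Require Import all_boot all_order all_algebra.
From mathcomp Require Import reals.
From mathcomp.real_closed Require Import complex.
From mathcomp Require Import mpoly.
Set Implicit Arguments. Unset Strict Implicit. Unset Printing Implicit Defensive.
Import GRing.Theory.
Local Open Scope ring_scope.

(* The Lie algebra q = sl_n ⋉ (m (F^n)^* ⊕ k F^n), F a field.
   An element of q is a triple (A, xi, v): A an n x n matrix (required to be
   traceless), xi an m x n matrix whose rows are the m covectors, and
   v an n x k matrix whose columns are the k vectors.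
   Bracket: [(A,xi,v),(B,eta,w)] = (AB - BA, A.eta - B.xi, Aw - Bv)
   where A acts on a covector (row) eta by A.eta = - eta A. *)
Definition qel (F : fieldType) (n m k : nat) : Type :=
  ('M[F]_n * 'M[F]_(m, n) * 'M[F]_(n, k))%type.

Definition in_q (F : fieldType) (n m k : nat) (x : qel F n m k) : Prop :=
  \tr x.1.1 = 0.

Definition qbr (F : fieldType) (n m k : nat) (x y : qel F n m k) : qel F n m k :=
  (x.1.1 *m y.1.1 - y.1.1 *m x.1.1,
   x.1.2 *m y.1.1 - y.1.2 *m x.1.1,   (* = xi B - eta A = A.eta - B.xi *)
   x.1.1 *m y.2 - y.1.1 *m x.2).

(* Index set of a basis of q:
   - sl_n part: pairs (i,j) except (n-1,n-1); basis element E_ij for i <> j,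
     E_ii - E_{n-1,n-1} for i = j;
   - (a, j) : 'I_m * 'I_n : the covector e_j^* in the a-th copy of (F^n)^*;
   - (j, b) : 'I_n * 'I_k : the vector e_j in the b-th copy of F^n. *)
Definition notlast (n : nat) (p : 'I_n * 'I_n) : bool :=
  ~~ ((p.1 == n.-1 :> nat) && (p.2 == n.-1 :> nat)).

Definition qidx (n m k : nat) : finType :=
  ({p : 'I_n * 'I_n | notlast p} + ('I_m * 'I_n) + ('I_n * 'I_k))%type.

Definition Ediag (F : fieldType) (n : nat) (i j : 'I_n) : 'M[F]_n :=
  \matrix_(r, c) ((r == i) && (c == j))%:R.

Definition qbasis (F : fieldType) (n m k : nat) (t : qidx n m k) : qel F n m k :=
  match t with
  | inl (inl p) =>
      let i := (val p).1 in let j := (val p).2 in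
      (if i == j then
         \matrix_(r, c) (((r == i) && (c == i))%:R
                         - ((r == n.-1 :> nat) && (c == n.-1 :> nat))%:R)
       else Ediag F i j, 0, 0)
  | inl (inr (a, j)) => (0, \matrix_(r, c) ((r == a) && (c == j))%:R, 0)
  | inr (j, b) => (0, 0, \matrix_(r, c) ((r == j) && (c == b))%:R)
  end.

(* Coordinates of an element of q (with traceless matrix part) in that basis. *)
Definition qcoord (F : fieldType) (n m k : nat) (x : qel F n m k) (t : qidx n m k) : F :=
  match t with
  | inl (inl p) => x.1.1 (val p).1 (val p).2
  | inl (inr (a, j)) => x.1.2 a j
  | inr (j, b) => x.2 j b
  end.

(* C[q^*] = S(q): polynomial ring in the basis elements of q. *)
Definition qdim (n m k : nat) : nat := #|{: qidx n m k}|.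

Definition Sq (F : fieldType) (n m k : nat) : Type := {mpoly F[qdim n m k]}.

Definition qvar (F : fieldType) (n m k : nat) (t : qidx n m k) : Sq F n m k :=
  'X_(enum_rank t).

Definition qlin (F : fieldType) (n m k : nat) (y : qel F n m k) : Sq F n m k :=
  \sum_(t : qidx n m k) qcoord y t *: qvar F t.

(* The derivation of S(q) extending ad x (coadjoint action of x on C[q^*]). *)
Definition adS (F : fieldType) (n m k : nat) (x : qel F n m k) (P : Sq F n m k)
  : Sq F n m k :=
  \sum_(t : qidx n m k) mderiv (enum_rank t) P * qlin (qbr x (qbasis F t)).

(* Invariants C[q^*]^Q = S(q)^q (Q connected with Lie algebra q). *)
Definition q_invariant (F : fieldType) (n m k : nat) (P : Sq F n m k) : Prop :=
  forall x : qel F n m k, in_q x -> adS x P = 0.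

Definition is_polynomial_ring (F : fieldType) (N : nat) (A : {mpoly F[N]} -> Prop)
  : Prop :=
  exists (r : nat) (g : r.-tuple {mpoly F[N]}),
    (forall i : 'I_r, A (tnth g i)) /\
    (forall P : {mpoly F[r]}, comp_mpoly g P = 0 -> P = 0) /\
    (forall f, A f -> exists P : {mpoly F[r]}, f = comp_mpoly g P).

(* Main.v *)
(* Write r = m - k and n - m = q r + s with 0 < s < r. A point of q^* is a triple
   (A, v, xi) of an n x n matrix modulo scalars, an n x m matrix and a k x n
   matrix. Grade C[q^*] by the degree in v and the degrees beta_b in the rows of
   xi; for a homogeneous invariant, deg_v - sum_b beta_b = n z with z an integer
   (torus weights).

   Degree bound: a nonzero invariant satisfies z (n - m) <= r beta_b for all b, so
   z >= 1 forces beta_b >= q + 1. Indeed, an sl_2-type commutator argument shows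
   that its degree along a rank one direction A + t u c is at most beta_b, hence at
   most r beta_b along a direction of rank r; and at a generic point there is a
   direction of rank r along which the action of an idempotent of gl_n makes it
   homogeneous of degree z (n - m).

   The entries y_ba of xi v are invariant, and so are the maximal minors f_a of a
   Sylvester matrix of the pencil [[A + t, v], [xi, 0]]; the latter have z = 1 and
   beta_b = q + 1. If f_a is a sum of products P Q of homogeneous invariants without
   constant term, one factor has z >= 1 and takes up all the degree in xi, so the
   other depends on A alone and is therefore constant: f_a is indecomposable. But
   sum_a y_ba f_a = 0, because a matrix with two dependent rows is singular, and
   such a relation cannot hold between independent linear parts. *)
Require Import Defs.
From HB Require Import structures.
From mathcomp Require Import all_boot all_order all_algebra.
From mathcomp Require Import reals.
From mathcomp.real_closed Require Import complex.
From mathcomp Require Import perm mpoly ring zify.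
Set Implicit Arguments. Unset Strict Implicit. Unset Printing Implicit Defensive.
Import Order.TTheory GRing.Theory Num.Theory.
Local Open Scope ring_scope.

(** The generators in [is_polynomial_ring] carry no grading. The relation sum_a y_ba f_a = 0 is
    therefore studied in m / m^2, for m the ideal of invariants without constant term; this only
    requires recentring the generators at 0. Homogeneity enters afterwards: weight components of
    invariants are invariant, so an element of m^2 has in each weight a sum of products of
    homogeneous elements of m. Such products vanish in the weight of f_a by the degree bound, and in
    the weight of y_ba because n > 1 divides deg_v - sum_b beta_b. Both parts of 0 < s < r matter.
    From s > 0 comes r q < n - m, hence beta_b >= q + 1 instead of q. From s < r comes k + s + 1 <=
    m, where k + s + 1 is the size of the truncated last column block of the Sylvester matrix,
    forced by asking for one column more than rows. The group itself never appears: finite motions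
    come from integrating derivations along lines of q^*, and polynomial identities are checked at
    all triples (A, v, xi). *)

Lemma poly_fun0 (F : numFieldType) (p : {poly F}) : (forall t, p.[t] = 0) -> p = 0.
Proof.
move=> p0; apply/eqP/negP => /negP pn0.
have := max_poly_roots pn0 (rs := [seq i%:R | i <- iota 0 (size p)]).
rewrite size_map size_iota ltnn => H; suff: false by [].
apply: H; first by apply/allP=> x _; apply/rootP/p0.
rewrite map_inj_uniq ?iota_uniq // => i j /eqP; rewrite eqr_nat => /eqP //.
Qed.

(** * Derivations, lines and gradings of polynomial rings *)

Section VectorFields.
Variables (R : comNzRingType) (N : nat).
Implicit Types (P Q : {mpoly R[N]}) (l : 'I_N -> {mpoly R[N]}) (d : 'I_N -> R).

Definition vfield l P := \sum_i P^`M(i) * l i.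
Definition dird d P := \sum_i d i *: P^`M(i).

Lemma vfield_is_additive l : additive (vfield l).
Proof.
move=> P Q; rewrite /vfield -sumrB; apply: eq_bigr => i _.
by rewrite mderivB mulrBl.
Qed.
HB.instance Definition _ l :=
  GRing.isAdditive.Build {mpoly R[N]} {mpoly R[N]} (vfield l) (vfield_is_additive l).

Lemma vfieldZ l c P : vfield l (c *: P) = c *: vfield l P.
Proof. by rewrite /vfield scaler_sumr; apply: eq_bigr => i _; rewrite mderivZ scalerAl. Qed.

Lemma vfieldM l P Q : vfield l (P * Q) = vfield l P * Q + P * vfield l Q.
Proof.
rewrite /vfield mulr_suml mulr_sumr -big_split /=; apply: eq_bigr => i _.
by rewrite mderivM mulrDl mulrAC mulrA.
Qed.

Lemma vfieldC l c : vfield l c%:MP = 0.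
Proof. by rewrite /vfield big1 // => i _; rewrite mderivC mul0r. Qed.

Lemma vfieldX l i : vfield l 'X_i = l i.
Proof.
rewrite /vfield (bigD1 i) //= big1 ?addr0 => [|j ji].
  rewrite mderivX mnm1E eqxx scale1r.
  have -> : (U_(i) - U_(i) = 0)%MM by apply/mnmP => j; rewrite mnmBE subnn mnm0E.
  by rewrite mpolyX0 mul1r.
by rewrite mderivX mnm1E eq_sym (negPf ji) scale0r mul0r.
Qed.

Lemma dirdE d P : dird d P = vfield (fun i => (d i)%:MP) P.
Proof. by apply: eq_bigr => i _; rewrite mulrC mul_mpolyC. Qed.

Lemma eq_vfield l l' P : l =1 l' -> vfield l P = vfield l' P.
Proof. by move=> e; apply: eq_bigr => i _; rewrite e. Qed.

Lemma eq_dird d d' P : d =1 d' -> dird d P = dird d' P.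
Proof. by move=> e; apply: eq_bigr => i _; rewrite e. Qed.

Lemma dird_is_additive d : additive (dird d).
Proof. by move=> P Q; rewrite !dirdE raddfB. Qed.
HB.instance Definition _ d :=
  GRing.isAdditive.Build {mpoly R[N]} {mpoly R[N]} (dird d) (dird_is_additive d).

Lemma dirdZ d c P : dird d (c *: P) = c *: dird d P.
Proof. by rewrite !dirdE vfieldZ. Qed.

Lemma dird_mderiv d i P : dird d P^`M(i) = (dird d P)^`M(i).
Proof.
rewrite /dird raddf_sum /=; apply: eq_bigr => j _.
by rewrite mderivZ mderiv_comm.
Qed.

(** The commutator of a constant field with [vfield l] is the field of the derivatives of [l]. For
    linear [l] that field is again constant, which is how [dird_adS] uses it. *)
Lemma dird_vfield d l P :
  dird d (vfield l P) = vfield l (dird d P) + vfield (fun i => dird d (l i)) P.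
Proof.
rewrite {1 2 3}/vfield raddf_sum -big_split /=; apply: eq_bigr => i _.
by rewrite [LHS]dirdE vfieldM -!dirdE dird_mderiv.
Qed.

Lemma dirdC d d' P : dird d (dird d' P) = dird d' (dird d P).
Proof.
rewrite [dird d' P]dirdE [RHS]dirdE dird_vfield -[RHS]addr0; congr (_ + _).
by rewrite /vfield big1 // => i _; rewrite dirdE vfieldC mulr0.
Qed.

Lemma dirdD d d' P : dird (fun i => d i + d' i) P = dird d P + dird d' P.
Proof. by rewrite /dird -big_split; apply: eq_bigr => i _; rewrite scalerDl. Qed.

Lemma meval_dird d P v : (dird d P).@[v] = \sum_i d i * (P^`M(i)).@[v].
Proof. by rewrite /dird raddf_sum; apply: eq_bigr => i _; rewrite /= mevalZ. Qed.

Lemma meval_vfield l P v :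
  (vfield l P).@[v] = (dird (fun i => (l i).@[v]) P).@[v].
Proof.
rewrite meval_dird /vfield raddf_sum; apply: eq_bigr => i _.
by rewrite /= mevalM mulrC.
Qed.

End VectorFields.

Section Lines.
Variables (F : numFieldType) (N : nat).
Implicit Types (P Q : {mpoly F[N]}) (d v : 'I_N -> F).

Definition pline v d P : {poly F} :=
  mmap polyC (fun i => (v i)%:P + (d i)%:P * 'X) P.

Lemma horner_pline v d P t : (pline v d P).[t] = P.@[fun i => v i + d i * t].
Proof.
rewrite /pline /mmap horner_sum mevalE; apply: eq_bigr => m _.
rewrite hornerCM /mmap1 horner_prod; congr (_ * _); apply: eq_bigr => i _.
by rewrite horner_exp !hornerE.
Qed.

(** Serves the chain rule [deriv_pline]: both of its sides are derivations over the morphism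
    [pline], so it is enough to compare them on the variables. *)
Lemma mpoly_derivation_eq (S : comNzRingType) (f : {rmorphism {mpoly F[N]} -> S})
    (D D' : {additive {mpoly F[N]} -> S}) :
  (forall c P, D (c *: P) = f c%:MP * D P) -> (forall c P, D' (c *: P) = f c%:MP * D' P) ->
  (forall P Q, D (P * Q) = D P * f Q + f P * D Q) ->
  (forall P Q, D' (P * Q) = D' P * f Q + f P * D' Q) ->
  (forall i, D 'X_i = D' 'X_i) -> D =1 D'.
Proof.
move=> DZ D'Z DM D'M DX P.
have D1 : D 1 = 0.
  by move: (DM 1 1); rewrite !mulr1 rmorph1 mulr1 mul1r => /eqP; rewrite -subr_eq subrr => /eqP.
have D'1 : D' 1 = 0.
  by move: (D'M 1 1); rewrite !mulr1 rmorph1 mulr1 mul1r => /eqP; rewrite -subr_eq subrr => /eqP.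
rewrite [P]mpolyE !raddf_sum; apply: eq_bigr => m _; rewrite DZ D'Z; congr (_ * _).
rewrite mpolyXE_id; elim/big_rec: _ => [|i Q _ IH]; first by rewrite D1 D'1.
rewrite DM D'M IH; congr (_ * _ + _).
elim: (m i) => [|e IHe]; first by rewrite expr0 D1 D'1.
by rewrite exprS DM D'M IHe DX.
Qed.

Lemma plineZ v d c P : pline v d (c *: P) = c%:P * pline v d P.
Proof. exact: mmapZ. Qed.

Lemma plineM v d P Q : pline v d (P * Q) = pline v d P * pline v d Q.
Proof. exact: rmorphM. Qed.

Lemma pline_additive v d : additive (pline v d).
Proof. exact: raddfB. Qed.
HB.instance Definition _ v d :=
  GRing.isAdditive.Build {mpoly F[N]} {poly F} (pline v d) (pline_additive v d).

Lemma deriv_pline v d P : (pline v d P)^`() = pline v d (dird d P).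
Proof.
pose f : {rmorphism {mpoly F[N]} -> {poly F}} :=
  mmap polyC (fun i => (v i)%:P + (d i)%:P * 'X).
have fE Q : f Q = pline v d Q by [].
pose D : {additive {mpoly F[N]} -> {poly F}} := (@deriv F) \o pline v d.
pose D' : {additive {mpoly F[N]} -> {poly F}} := pline v d \o dird d.
rewrite -[LHS]/(D P) -[RHS]/(D' P).
apply: (@mpoly_derivation_eq _ f) => [c Q|c Q|Q Q'|Q Q'|i] /=.
- by rewrite plineZ derivM derivC mul0r add0r fE /pline mmapC.
- by rewrite dirdZ plineZ fE /pline mmapC.
- by rewrite !fE plineM derivM.
- by rewrite !fE dirdE vfieldM raddfD /= !plineM -!dirdE.
rewrite dirdE vfieldX /pline mmapX mmap1U mmapC.
by rewrite derivD derivC add0r derivM derivC mul0r add0r derivX mulr1.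
Qed.

Lemma mderiv0_const P : (forall i, P^`M(i) = 0) -> P = (P@_0)%:MP.
Proof.
move=> dP; apply/mpolyP => m; rewrite mcoeffC.
case: (eqVneq m 0%MM) => [->|m0]; first by rewrite mulr1.
have [i mi] : exists i, m i != 0%N.
  apply/existsP; apply: contraR m0; rewrite negb_exists => /forallP m0.
  by apply/eqP/mnmP => i; rewrite mnm0E; apply/eqP; move: (m0 i); rewrite negbK.
have := mcoeff_deriv i (m - U_(i))%MM P.
rewrite dP mcoeff0 submK; last by rewrite lep1mP.
by rewrite mulr0 => /esym/eqP; rewrite -mulr_natr mulf_eq0 pnatr_eq0 orbF => /eqP.
Qed.

(** Induction on the degree: on a coordinate line [P] is the zero polynomial in one variable, so its
    partial derivatives vanish at all points as well. They are zero by induction, and [P] is a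
    constant. *)
Lemma mpoly_fun0 P : (forall v, P.@[v] = 0) -> P = 0.
Proof.
have [s] := ubnP (msize P); elim: s P => // s IH P; rewrite ltnS => sP P0.
have [->//|Pn0] := eqVneq P 0.
have dP i : P^`M(i) = 0.
  apply: IH => [|v].
    case: s sP => [|s] sP.
      by move: sP; rewrite leqn0 msize_poly_eq0 (negPf Pn0).
    rewrite ltnS msizeE; apply/bigmax_leqP_seq => m mP _; move: mP.
    rewrite mcoeff_msupp mcoeff_deriv -mulr_natr mulf_eq0 negb_or => /andP[+ _].
    rewrite -mcoeff_msupp => /msize_mdeg_lt; rewrite mdegD mdeg1 addn1 => h.
    by have := leq_trans h sP; rewrite ltnS.
  have H : pline v (fun j => (j == i)%:R) P = 0.
    by apply: poly_fun0 => t; rewrite horner_pline P0.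
  have := congr1 (fun p => (p^`()).[0]) H; rewrite deriv_pline horner_pline raddf0 horner0.
  rewrite /dird (bigD1 i) //= eqxx scale1r big1 ?addr0 => [|j ji].
    by move=> <-; apply: meval_eq => j; rewrite mulr0 addr0.
  by rewrite (negPf ji) scale0r.
have PC := mderiv0_const dP; have := P0 (fun=> 0).
by rewrite PC mevalC => ->; rewrite mpolyC0.
Qed.

End Lines.

Section Grading.
Variables (F : numFieldType) (N : nat) (W : zmodType) (cl : 'I_N -> W).
Implicit Types (P Q : {mpoly F[N]}) (m : 'X_{1..N}) (w : W).

Definition mwt m : W := \sum_i cl i *+ m i.

Lemma mwtD m m' : mwt (m + m')%MM = mwt m + mwt m'.
Proof. by rewrite /mwt -big_split; apply: eq_bigr => i _; rewrite mnmDE mulrnDr. Qed.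

Lemma mwt0 : mwt 0%MM = 0.
Proof. by rewrite /mwt big1 // => i _; rewrite mnm0E. Qed.

Lemma mwtU i : mwt U_(i)%MM = cl i.
Proof.
rewrite /mwt (bigD1 i) //= mnm1E eqxx big1 ?addr0 // => j ji.
by rewrite mnm1E eq_sym (negPf ji).
Qed.

Definition whom w P := forall m, P@_m != 0 -> mwt m = w.

Definition wcomp w P : {mpoly F[N]} :=
  \sum_(m <- msupp P | mwt m == w) P@_m *: 'X_[m].

Lemma mcoeff_wcomp w P m : (wcomp w P)@_m = if mwt m == w then P@_m else 0.
Proof.
rewrite /wcomp raddf_sum /=.
have [mP|mP] := boolP (m \in msupp P); last first.
  rewrite big1_seq => [|m' /andP[_ m'P]].
    by rewrite (memN_msupp_eq0 mP) if_same.
  rewrite mcoeffZ mcoeffX; case: eqP mP m'P => [->|]; last by rewrite mulr0.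
  by move=> /negPf->.
rewrite big_mkcond (bigD1_seq m) //= ?msupp_uniq // big1 ?addr0.
  by rewrite mcoeffZ mcoeffX eqxx mulr1; case: ifP; rewrite ?mcoeff0.
move=> m' m'm; case: ifP => _; last by rewrite ?mcoeff0.
by rewrite mcoeffZ mcoeffX (negPf m'm) mulr0.
Qed.

Lemma wcomp_is_additive w : additive (wcomp w).
Proof.
move=> P Q; apply/mpolyP => m; rewrite mcoeffB !mcoeff_wcomp mcoeffB.
by case: ifP; rewrite ?subr0.
Qed.
HB.instance Definition _ w :=
  GRing.isAdditive.Build {mpoly F[N]} {mpoly F[N]} (wcomp w) (wcomp_is_additive w).

Lemma wcompZ w c P : wcomp w (c *: P) = c *: wcomp w P.
Proof.
apply/mpolyP => m; rewrite mcoeffZ !mcoeff_wcomp mcoeffZ.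
by case: ifP; rewrite ?mulr0.
Qed.

Lemma whom_comp w P : whom w (wcomp w P).
Proof. by move=> m; rewrite mcoeff_wcomp; case: ifP => [/eqP-> //|_]; rewrite eqxx. Qed.

Lemma wcomp_whom w w' P : whom w' P -> wcomp w P = if w' == w then P else 0.
Proof.
move=> hP; apply/mpolyP => m; rewrite mcoeff_wcomp.
have [Pm|Pm] := eqVneq P@_m 0.
  by rewrite Pm if_same; case: ifP; rewrite ?mcoeff0.
by rewrite (hP _ Pm); case: ifP; rewrite ?mcoeff0.
Qed.

Lemma whom0 w : whom w 0.
Proof. by move=> m; rewrite mcoeff0 eqxx. Qed.

Lemma whomD w P Q : whom w P -> whom w Q -> whom w (P + Q).
Proof.
move=> hP hQ m; rewrite mcoeffD; have [P0|/hP//] := eqVneq P@_m 0.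
by rewrite P0 add0r => /hQ.
Qed.

Lemma whomZ w c P : whom w P -> whom w (c *: P).
Proof. by move=> hP m; rewrite mcoeffZ mulf_eq0 negb_or => /andP[_ /hP]. Qed.

Lemma whomN w P : whom w P -> whom w (- P).
Proof. by rewrite -scaleN1r; apply: whomZ. Qed.

Lemma whom_sum w (I : Type) (r : seq I) (p : pred I) (G : I -> {mpoly F[N]}) :
  (forall i, p i -> whom w (G i)) -> whom w (\sum_(i <- r | p i) G i).
Proof.
by move=> hG; elim/big_rec: _ => [|i Q pi]; [apply: whom0 | apply/whomD/hG].
Qed.

Lemma whomC c : whom 0 c%:MP.
Proof.
move=> m; rewrite mcoeffC mulf_eq0 negb_or => /andP[_].
by have [->|] := eqVneq m 0%MM; rewrite ?mwt0 // eqxx.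
Qed.

Lemma whomX m : whom (mwt m) 'X_[m].
Proof. by move=> m'; rewrite mcoeffX; have [->|] := eqVneq m m'; rewrite ?eqxx. Qed.

Lemma whomXU i : whom (cl i) 'X_i.
Proof. by rewrite -mwtU; apply: whomX. Qed.

Lemma whomM w w' P Q : whom w P -> whom w' Q -> whom (w + w') (P * Q).
Proof.
move=> hP hQ; rewrite mpolyME; apply: whom_sum => -[m m'] _ /=.
have [->|Pm] := eqVneq P@_m 0; first by rewrite mul0r scale0r; apply: whom0.
have [->|Qm] := eqVneq Q@_m' 0; first by rewrite mulr0 scale0r; apply: whom0.
by apply: whomZ; rewrite -(hP _ Pm) -(hQ _ Qm) -mwtD; apply: whomX.
Qed.

Lemma whom_prod (I : Type) (r : seq I) (w : I -> W) (G : I -> {mpoly F[N]}) :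
  (forall i, whom (w i) (G i)) -> whom (\sum_(i <- r) w i) (\prod_(i <- r) G i).
Proof.
move=> hG; elim: r => [|i r IH]; first by rewrite !big_nil; apply: whomC.
by rewrite !big_cons; apply: whomM.
Qed.

Lemma whom_mderiv w i P : whom w P -> whom (w - cl i) P^`M(i).
Proof.
move=> hP m; rewrite mcoeff_deriv -mulr_natr mulf_eq0 negb_or => /andP[/hP + _].
by rewrite mwtD mwtU => <-; rewrite addrK.
Qed.

Lemma whom_vfield l s w P :
  (forall i, whom (cl i + s) (l i)) -> whom w P -> whom (w + s) (vfield l P).
Proof.
move=> hl hP; apply: whom_sum => i _.
have -> : w + s = (w - cl i) + (cl i + s) by rewrite addrA subrK.
by apply: whomM (hl i); apply: whom_mderiv.
Qed.

Lemma wcomp_vfield l s w P : (forall i, whom (cl i + s) (l i)) ->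
  vfield l (wcomp w P) = wcomp (w + s) (vfield l P).
Proof.
move=> hl; rewrite [P]mpolyE.
rewrite (raddf_sum (wcomp w)) (raddf_sum (vfield l)) (raddf_sum (vfield l)) (raddf_sum (wcomp (w + s))).
apply: eq_bigr => m _ /=.
rewrite wcompZ !vfieldZ wcompZ; congr (_ *: _).
rewrite (wcomp_whom _ (@whomX m)) (wcomp_whom _ (whom_vfield hl (@whomX m))).
by rewrite (inj_eq (addIr s)); case: ifP; rewrite ?raddf0.
Qed.

Lemma wcompE P : P = \sum_(w <- undup [seq mwt m | m <- msupp P]) wcomp w P.
Proof.
apply/mpolyP => m; rewrite raddf_sum /=.
have [mP|mP] := boolP (m \in msupp P); last first.
  rewrite big1 ?(memN_msupp_eq0 mP) // => w _.
  by rewrite mcoeff_wcomp (memN_msupp_eq0 mP) if_same.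
rewrite (bigD1_seq (mwt m)) ?undup_uniq //=; last by rewrite mem_undup map_f.
rewrite mcoeff_wcomp eqxx big1 ?addr0 // => w wm.
by rewrite mcoeff_wcomp eq_sym (negPf wm).
Qed.

Lemma wcompM w P Q :
  wcomp w (P * Q) =
  \sum_(a <- undup [seq mwt m | m <- msupp P]) wcomp a P * wcomp (w - a) Q.
Proof.
rewrite {1}[P]wcompE mulr_suml raddf_sum /=; apply: eq_bigr => a _.
rewrite {1}[Q]wcompE mulr_sumr raddf_sum /=.
transitivity (\sum_(b <- undup [seq mwt m | m <- msupp Q])
    (if b == w - a then wcomp a P * wcomp b Q else 0)).
  apply: eq_bigr => b _.
  rewrite (wcomp_whom _ (whomM (@whom_comp a P) (@whom_comp b Q))).
  by rewrite [b == _]eq_sym subr_eq [_ == w]eq_sym addrC.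
rewrite -big_mkcond /=.
have [wQ|wQ] := boolP (w - a \in undup [seq mwt m | m <- msupp Q]).
  rewrite big_mkcond (bigD1_seq (w - a)) ?undup_uniq //= eqxx big1 ?addr0 //.
  by move=> b /negPf->.
rewrite big1_seq => [|b /andP[/eqP-> bQ]]; last by rewrite bQ in wQ.
suff -> : wcomp (w - a) Q = 0 by rewrite mulr0.
rewrite /wcomp big1_seq // => m /andP[/eqP mw mQ].
by case/negP: wQ; rewrite mem_undup -mw map_f.
Qed.

(** Monomials are eigenvectors of a diagonal field. Both the torus weights and the degree count
    [wdef] are read off from this eigenvalue. *)
Lemma mcoeff_euler (c : 'I_N -> F) P m :
  (vfield (fun i => c i *: 'X_i) P)@_m = (\sum_i c i * (m i)%:R) * P@_m.
Proof.
rewrite [in LHS](mpolyE P) (raddf_sum (vfield _)) raddf_sum /=.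
transitivity (\sum_(m' <- msupp P) (\sum_i c i * (m' i)%:R) * (P@_m' * (m' == m)%:R)).
  apply: eq_bigr => m' _; rewrite vfieldZ mcoeffZ mulrCA; congr (_ * _).
  rewrite /vfield raddf_sum mulr_suml; apply: eq_bigr => i _ /=.
  rewrite mderivX -scalerAl -scalerAr !mcoeffZ mulrA [(m' i)%:R * _]mulrC -!mulrA; congr (_ * _).
  have [->|mi] := eqVneq (m' i) 0%N; first by rewrite !mul0r.
  by rewrite -mpolyXD submK ?lep1mP // mcoeffX.
have [mP|mP] := boolP (m \in msupp P).
  rewrite (bigD1_seq m) ?msupp_uniq //= eqxx mulr1 [X in _ + X]big1 ?addr0 //.
  by move=> m' /negPf->; rewrite !mulr0.
rewrite (memN_msupp_eq0 mP) mulr0 big1_seq // => m' /= m'P.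
by case: eqP mP m'P => [->/negPf->|_]; rewrite ?mulr0.
Qed.

End Grading.

(** * Nilpotent operators and derivations of determinants *)

(** Nilpotency is assumed at the vector [x] only. Induction on a + b replaces the binomial formula:
    passing to [f x] lowers a, passing to [g x] lowers b. *)
Lemma iter_add_nilpotent (V : zmodType) (f g : {additive V -> V}) :
  (forall x, f (g x) = g (f x)) -> forall a b x,
  iter a.+1 f x = 0 -> iter b.+1 g x = 0 ->
  iter (a + b).+1 (fun y => f y + g y) x = 0.
Proof.
move=> fgC.
have it0 (h : {additive V -> V}) c : iter c h 0 = 0.
  by elim: c => //= c ->; rewrite raddf0.
have itC c x : iter c g (f x) = f (iter c g x).
  by elim: c => //= c ->; rewrite fgC.
have itC' c x : iter c f (g x) = g (iter c f x).
  by elim: c => //= c ->; rewrite fgC.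
pose h : {additive V -> V} := (f \+ g)%R.
have itD c x y : iter c h (x + y) = iter c h x + iter c h y.
  by elim: c => //= c ->; rewrite [f _]raddfD [g _]raddfD addrACA.
suff H s : forall a b x, (a + b = s)%N ->
    iter a.+1 f x = 0 -> iter b.+1 g x = 0 -> iter s.+1 h x = 0.
  by move=> a b x; apply: H.
elim: s => [|s IH] a b x abs fx gx.
  by case: a b abs fx gx => [|a] [|b] //= _ -> ->; rewrite addr0.
rewrite iterSr -[h x]/(f x + g x) itD.
have -> : iter s.+1 h (f x) = 0.
  case: a abs fx => [|a] abs fx; first by rewrite /= in fx; rewrite fx it0.
  apply: (IH a b); first by case: abs.
    by rewrite -iterSr.
  by rewrite itC gx raddf0.
have -> : iter s.+1 h (g x) = 0.
  case: b abs gx => [|b] abs gx; first by rewrite /= in gx; rewrite gx it0.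
  apply: (IH a b); first by move: abs; rewrite addnS => -[].
    by rewrite itC' fx raddf0.
  by rewrite -iterSr.
by rewrite addr0.
Qed.

(* D (E^c x) = - c C (E^(c-1) x): applying D to C^a E^c x = 0 trades one E for one C. *)
Lemma iter_commutator_nilpotent (F : numFieldType) (V : lmodType F)
    (E D C : {additive V -> V}) :
  (forall x, E (D x) = D (E x) + C x) -> (forall x, C (E x) = E (C x)) ->
  (forall x, C (D x) = D (C x)) ->
  forall e x, D x = 0 -> iter e E x = 0 -> iter e C x = 0.
Proof.
move=> ED CE CD e x Dx Ex.
have CEi c y : C (iter c E y) = iter c E (C y).
  by elim: c => //= c IH; rewrite CE IH.
have CDi c y : iter c C (D y) = D (iter c C y).
  by elim: c => //= c ->; rewrite CD.
have DE c : D (iter c.+1 E x) = - (C (iter c E x) *+ c.+1).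
  elim: c => [|c IH] /=.
    by have := ED x; rewrite Dx raddf0 => /esym/eqP; rewrite addr_eq0 => /eqP.
  have -> : D (E (iter c.+1 E x)) = E (D (iter c.+1 E x)) - C (iter c.+1 E x).
    by rewrite ED addrK.
  by rewrite IH raddfN raddfMn /= -CE -opprD -mulrSr.
have CMn c y j : iter c C (- (y *+ j)) = - (iter c C y *+ j).
  by elim: c => //= c ->; rewrite raddfN raddfMn.
suff H c : (c <= e)%N -> iter c C (iter (e - c) E x) = 0.
  by have := H e (leqnn e); rewrite subnn.
elim: c => [|c IH] ce; first by rewrite subn0.
have := IH (ltnW ce); rewrite -subSS subSn // => /(congr1 D).
rewrite raddf0 -CDi DE CMn => /eqP; rewrite oppr_eq0 -iterSr.
by rewrite -scaler_nat scaler_eq0 pnatr_eq0 => /eqP.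
Qed.

Section Derivation.
Variables (S : comNzRingType) (D : {additive S -> S}).
Hypothesis DM : forall x y, D (x * y) = D x * y + x * D y.

Lemma derivation1 : D 1 = 0.
Proof.
by have := DM 1 1; rewrite !mulr1 mul1r => /eqP; rewrite -subr_eq subrr => /eqP.
Qed.

Lemma derivation_prod (I : finType) (G : I -> S) :
  D (\prod_i G i) = \sum_i D (G i) * \prod_(j | j != i) G j.
Proof.
suff H (r : seq I) : uniq r -> D (\prod_(i <- r) G i) =
    \sum_(i <- r) D (G i) * \prod_(j <- r | j != i) G j.
  exact: H (index_enum_uniq I).
elim: r => [|i r IH] /=; first by rewrite !big_nil derivation1.
case/andP=> ir ur; rewrite !big_cons DM IH // eqxx /=; congr (_ * _ + _).
  rewrite [RHS]big_seq_cond [LHS]big_seq; apply: eq_bigl => j.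
  by have [jr|//] := boolP (j \in r); apply/esym; apply: contraNneq ir => <-.
rewrite mulr_sumr; apply: eq_big_seq => j jr.
rewrite big_cons mulrCA; case: eqVneq => [ij|//].
by rewrite ij jr in ir.
Qed.

(** Jacobi's formula: differentiate one row at a time, then expand along that row. *)
Lemma derivation_det n (M : 'M[S]_n) :
  D (\det M) = \tr (map_mx D M *m \adj M).
Proof.
pose M' i := \matrix_(k, j) if k == i then D (M i j) else M k j.
have -> : D (\det M) = \sum_i \det (M' i).
  rewrite /determinant raddf_sum exchange_big; apply: eq_bigr => s _ /=.
  rewrite -mulr_sumr; have -> (e : bool) (x : S) : D ((-1) ^+ e * x) = (-1) ^+ e * D x.
    by case: e; rewrite ?expr0 ?expr1 ?mul1r // !mulN1r raddfN.
  congr (_ * _); rewrite derivation_prod; apply: eq_bigr => i _.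
  rewrite [RHS](bigD1 i) //= mxE eqxx; congr (_ * _); apply: eq_bigr => j ji.
  by rewrite mxE (negPf ji).
rewrite /mxtrace; apply: eq_bigr => i _.
rewrite (expand_det_row _ i) mxE; apply: eq_bigr => j _.
rewrite !mxE eqxx; congr (_ * _); rewrite /cofactor; congr (_ * \det _).
by apply/matrixP => a b; rewrite !mxE eq_sym (negPf (neq_lift _ _)).
Qed.

Variables (I J : finType) (eIJ : #|I| = #|J|).

(** Rows and columns are indexed by different finite types of equal size, so that block indices can
    be sum types; the enumerations affect the determinant by a sign at most. *)
Definition fmx (G : I -> J -> S) : 'M[S]_#|I| :=
  \matrix_(i, j) G (enum_val i) (enum_val (cast_ord eIJ j)).

(** Infinitesimal form of det (g G h) = det g det G det h, from Jacobi's formula and the two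
    adjugate identities. *)
Lemma derivation_fdet (G : I -> J -> S) (L : I -> I -> S) (C : J -> J -> S) :
  (forall i j, D (G i j) = \sum_i' L i i' * G i' j + \sum_j' G i j' * C j' j) ->
  D (\det (fmx G)) = (\sum_i L i i + \sum_j C j j) * \det (fmx G).
Proof.
move=> DG; rewrite derivation_det.
pose A : 'M[S]_#|I| := \matrix_(i, j) L (enum_val i) (enum_val j).
pose B : 'M[S]_#|I| :=
  \matrix_(i, j) C (enum_val (cast_ord eIJ i)) (enum_val (cast_ord eIJ j)).
have sumJ (E : J -> S) : \sum_j E j = \sum_(i < #|I|) E (enum_val (cast_ord eIJ i)).
  rewrite (reindex (fun i : 'I_#|J| => enum_val i)) /=; last exact/onW_bij/enum_val_bij.
  rewrite (reindex (cast_ord eIJ)) //=; apply: onW_bij.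
  by exists (cast_ord (esym eIJ)) => i; rewrite ?cast_ordK ?cast_ordKV.
have sumI (E : I -> S) : \sum_j E j = \sum_(i < #|I|) E (enum_val i).
  by rewrite (reindex (fun i : 'I_#|I| => enum_val i)) //=; apply/onW_bij/enum_val_bij.
have -> : map_mx D (fmx G) = A *m fmx G + fmx G *m B.
  apply/matrixP => i j; rewrite !mxE DG; congr (_ + _).
    by rewrite sumI; apply: eq_bigr => a _; rewrite !mxE.
  by rewrite sumJ; apply: eq_bigr => a _; rewrite !mxE.
rewrite mulmxDl linearD /= -mulmxA mul_mx_adj.
rewrite -mulmxA [X in _ + X]mxtrace_mulC -mulmxA mul_adj_mx.
rewrite !mul_mx_scalar !mxtraceZ mulrC [X in _ + X]mulrC -mulrDl; congr (_ * _).
by rewrite sumI sumJ; congr (_ + _); apply: eq_bigr => i _; rewrite mxE.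
Qed.

End Derivation.

(** All terms of the Leibniz expansion have the same weight, since a permutation only reorders the
    column weights. *)
Lemma whom_fdet (F : numFieldType) (N : nat) (W : zmodType) (cl : 'I_N -> W)
    (I J : finType) (eIJ : #|I| = #|J|) (G : I -> J -> {mpoly F[N]})
    (a : I -> W) (b : J -> W) :
  (forall i j, whom cl (a i + b j) (G i j)) ->
  whom cl (\sum_i a i + \sum_j b j) (\det (fmx eIJ G)).
Proof.
move=> hG; apply: whom_sum => s _.
have -> : \sum_i a i + \sum_j b j = \sum_(i < #|I|)
    (a (enum_val i) + b (enum_val (cast_ord eIJ (s i)))).
  rewrite big_split /=; congr (_ + _).
    by rewrite (reindex (fun i : 'I_#|I| => enum_val i)) //=; apply/onW_bij/enum_val_bij.
  rewrite (reindex (fun i : 'I_#|J| => enum_val i)) /=; last exact/onW_bij/enum_val_bij.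
  rewrite (reindex (cast_ord eIJ)) /=; last first.
    by apply: onW_bij; exists (cast_ord (esym eIJ)) => i; rewrite ?cast_ordK ?cast_ordKV.
  by rewrite (reindex_inj (@perm_inj _ s)).
have -> : (-1) ^+ s * \prod_i fmx eIJ G i (s i) =
    ((-1) ^+ s : F) *: \prod_i fmx eIJ G i (s i).
  by case: (odd_perm s); rewrite ?expr0 ?expr1 ?scale1r ?mul1r // mulN1r scaleN1r.
by apply: whomZ; apply: whom_prod => i; rewrite mxE.
Qed.

(** * Linear parts in a polynomial ring of invariants *)

Section PolynomialRing.
Variables (F : numFieldType) (N : nat).

Lemma meval_at0 n (P : {mpoly F[n]}) : P.@[fun=> 0] = P@_0.
Proof.
rewrite mevalE [in RHS](mpolyE P) raddf_sum; apply: eq_bigr => m _ /=.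
rewrite mcoeffZ mcoeffX; congr (_ * _).
have [->|m0] := eqVneq m 0%MM.
  by rewrite big1 // => i _; rewrite mnm0E expr0.
have [i mi] : exists i, m i != 0%N.
  apply/existsP; apply: contraR m0; rewrite negb_exists => /forallP m0.
  by apply/eqP/mnmP => i; rewrite mnm0E; apply/eqP; move: (m0 i); rewrite negbK.
by rewrite (bigD1 i) //= expr0n (negPf mi) mul0r.
Qed.

Lemma pline0_coef0 n (x : 'I_n -> F) (P : {mpoly F[n]}) :
  (pline (fun=> 0) x P)`_0 = P@_0.
Proof.
rewrite -horner_coef0 horner_pline -meval_at0; apply: meval_eq => i.
by rewrite mulr0 addr0.
Qed.

Lemma pline0_coef1 n (x : 'I_n -> F) (P : {mpoly F[n]}) :
  (pline (fun=> 0) x P)`_1 = \sum_i x i * P@_U_(i).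
Proof.
have := coef_deriv (pline (fun=> 0) x P) 0; rewrite mulr1n => <-.
rewrite deriv_pline pline0_coef0 /dird raddf_sum; apply: eq_bigr => i _ /=.
by rewrite mcoeffZ mcoeff_deriv mnm0E add0m.
Qed.

(** [A] is a subalgebra containing the scalars. *)
Definition alg_closed (A : {mpoly F[N]} -> Prop) :=
  [/\ forall c, A c%:MP, forall P Q, A P -> A Q -> A (P + Q)
    & forall P Q, A P -> A Q -> A (P * Q)].

(** Membership in m^2, for m the ideal of elements of [A] without constant term. *)
Definition aug_square (A : {mpoly F[N]} -> Prop) (f : {mpoly F[N]}) :=
  exists s : seq ({mpoly F[N]} * {mpoly F[N]}),
    (forall u, u \in s -> [/\ A u.1, A u.2, u.1@_0 = 0 & u.2@_0 = 0]) /\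
    f = \sum_(u <- s) u.1 * u.2.

(** Subtracting the constant terms of the generators amounts to the invertible substitution of X_i -
    a_i for X_i, which preserves independence and generation. *)
Lemma polynomial_ring_centered (A : {mpoly F[N]} -> Prop) :
  alg_closed A -> is_polynomial_ring A ->
  exists (r : nat) (g : r.-tuple {mpoly F[N]}),
    [/\ forall i : 'I_r, A (tnth g i) /\ (tnth g i)@_0 = 0,
        forall P : {mpoly F[r]}, P \mPo g = 0 -> P = 0
      & forall f, A f -> exists P : {mpoly F[r]}, f = P \mPo g].
Proof.
case=> AC AD AM [r [g [Ag [gi gs]]]].
pose a i := (tnth g i)@_0.
pose g' := [tuple tnth g i - (a i)%:MP | i < r].
have comp (P : {mpoly F[r]}) :
    P \mPo g' = (P \mPo [tuple 'X_i - (a i)%:MP | i < r]) \mPo g.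
  apply/eqP; rewrite -subr_eq0; apply/eqP/mpoly_fun0 => v.
  rewrite mevalB !comp_mpoly_meval; apply/eqP; rewrite subr_eq0; apply/eqP/meval_eq => i.
  by rewrite !tnth_mktuple !mevalB !mevalC mevalXU.
have comp' (P : {mpoly F[r]}) :
    P \mPo g = (P \mPo [tuple 'X_i + (a i)%:MP | i < r]) \mPo g'.
  apply/eqP; rewrite -subr_eq0; apply/eqP/mpoly_fun0 => v.
  rewrite mevalB !comp_mpoly_meval; apply/eqP; rewrite subr_eq0; apply/eqP/meval_eq => i.
  by rewrite !tnth_mktuple mevalD mevalXU mevalC tnth_mktuple mevalB mevalC subrK.
exists r, g'; split=> [i|P|f Af].
- rewrite tnth_mktuple; split; first by apply: AD; rewrite // -mpolyCN.
  by rewrite mcoeffB mcoeffC eqxx mulr1 subrr.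
- rewrite comp => /gi P0; apply: mpoly_fun0 => v.
  have := congr1 (meval (fun i => v i + a i)) P0.
  rewrite comp_mpoly_meval meval0 => <-; apply: meval_eq => i.
  by rewrite tnth_mktuple mevalB mevalXU mevalC addrK.
- by have [P ->] := gs f Af; exists (P \mPo [tuple 'X_i + (a i)%:MP | i < r]).
Qed.

(** Every monomial of [P] has degree at least two, so splitting off one variable leaves two factors
    without constant term. *)
Lemma comp_aug_square (A : {mpoly F[N]} -> Prop) r (g : r.-tuple {mpoly F[N]})
    (P : {mpoly F[r]}) :
  alg_closed A -> (forall i, A (tnth g i) /\ (tnth g i)@_0 = 0) ->
  P@_0 = 0 -> (forall i, P@_U_(i) = 0) -> aug_square A (P \mPo g).
Proof.
case=> AC AD AM Ag P0 P1.
have A1 : A 1 by rewrite -mpolyC1.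
have Acomp Q : A (Q \mPo g).
  rewrite comp_mpolyE; apply: big_ind => [||m _]; [by rewrite -mpolyC0|exact: AD|].
  rewrite -mul_mpolyC; apply: (AM) => //.
  apply: big_ind => [||i _]; [exact: A1|exact: AM|]; elim: (m i) => [|e IH]; first by rewrite expr0.
  by rewrite exprS; apply: (AM) => //; case: (Ag i).
have comp0 Q : (Q \mPo g)@_0 = Q@_0.
  rewrite -!meval_at0 comp_mpoly_meval; apply: meval_eq => i.
  by rewrite meval_at0; case: (Ag i).
have split_m m : m \in msupp P -> exists u : {mpoly F[N]} * {mpoly F[N]},
    [/\ A u.1, A u.2, u.1@_0 = 0 & u.2@_0 = 0] /\
    (P@_m *: 'X_[m]) \mPo g = u.1 * u.2.
  move=> mP; have m0 : m != 0%MM by apply: contraTneq mP => ->; rewrite mcoeff_msupp P0 eqxx.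
  have [i mi] : exists i, m i != 0%N.
    apply/existsP; apply: contraR m0; rewrite negb_exists => /forallP m0.
    by apply/eqP/mnmP => i; rewrite mnm0E; apply/eqP; move: (m0 i); rewrite negbK.
  exists ((P@_m *: 'X_i) \mPo g, 'X_[m - U_(i)] \mPo g); split; last first.
    by rewrite /= -rmorphM /= -scalerAl -mpolyXD addmC submK // lep1mP.
  split=> //=; rewrite comp0 ?mcoeffZ mcoeffX ?mnm1_eq0 ?mulr0 //.
  case: eqP => // mU; move: mP; rewrite mcoeff_msupp.
  have -> : m = U_(i)%MM by rewrite -[LHS](@submK _ U_(i)%MM) ?lep1mP // mU add0m.
  by rewrite P1 eqxx.
rewrite [P]mpolyE raddf_sum; elim: (msupp P) (fun m => split_m m) => {split_m} [|m s IH] H.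
  by exists [::]; split=> //; rewrite !big_nil.
have [u [Au Eu]] := H m (mem_head _ _).
have [t [At Et]] := IH (fun m' h => H m' (@mem_behead _ (m :: s) m' h)).
exists (u :: t); split; last by rewrite !big_cons /= Et -Eu.
by move=> w; rewrite in_cons => /orP[/eqP->|/At].
Qed.

(* In a polynomial ring with augmentation ideal m, a relation sum_j y_j f_j = 0
   between elements of m yields sum_j L(y_j) L(f_j) = 0 for the linear parts L
   taken in m / m^2. If the L(y_j) and L(f_(j0)) were linearly independent, one
   could specialize L(y_(j0)) and L(f_(j0)) to 1 and the other L(y_j) to 0. *)
Lemma polynomial_ring_relation (A : {mpoly F[N]} -> Prop) t
    (y f : 'I_t -> {mpoly F[N]}) (j0 : 'I_t) :
  alg_closed A -> is_polynomial_ring A ->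
  (forall j, A (y j) /\ (y j)@_0 = 0) -> (forall j, A (f j) /\ (f j)@_0 = 0) ->
  \sum_j y j * f j = 0 ->
  exists (a : 'I_t -> F) (b : F),
    (b != 0 \/ exists j, a j != 0) /\
    aug_square A (\sum_j a j *: y j + b *: f j0).
Proof.
move=> Acl Apoly Ay Af yf.
have [r [g [Ag gi gs]]] := polynomial_ring_centered Acl Apoly.
have comp0 Q : (Q \mPo g)@_0 = Q@_0.
  rewrite -!meval_at0 comp_mpoly_meval; apply: meval_eq => i.
  by rewrite meval_at0; case: (Ag i).
have [Y Yy] := fin_all_exists (fun j => gs _ (proj1 (Ay j))).
have [Z Zf] := fin_all_exists (fun j => gs _ (proj1 (Af j))).
have Y0 j : (Y j)@_0 = 0 by rewrite -comp0 -Yy; case: (Ay j).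
have Z0 j : (Z j)@_0 = 0 by rewrite -comp0 -Zf; case: (Af j).
pose lin (P : {mpoly F[r]}) : 'rV[F]_r := \row_i P@_U_(i).
pose MY := \matrix_(j < t) lin (Y j).
pose M := col_mx MY (lin (Z j0)).
have [Mfree|] := boolP (row_free M); last first.
  rewrite -kermx_eq0 => /rowV0Pn [x /sub_kermxP xM xn0].
  pose a j := x 0 (lshift 1 j); pose b := x 0 (rshift t 0).
  exists a, b; split.
    have [b0|] := eqVneq b 0; last by left.
    right; apply/existsP; apply: contraR xn0; rewrite negb_exists => /forallP a0.
    apply/eqP/rowP => j; rewrite mxE -(splitK j).
    case: (split j) => {}j /=; last by rewrite ord1.
    by apply/eqP; move: (a0 j); rewrite negbK.
  have -> : \sum_j a j *: y j + b *: f j0 = (\sum_j a j *: Y j + b *: Z j0) \mPo g.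
    rewrite raddfD raddf_sum /= comp_mpolyZ -Zf; congr (_ + _).
    by apply: eq_bigr => j _; rewrite comp_mpolyZ -Yy.
  apply: comp_aug_square => // [|i]; rewrite mcoeffD raddf_sum mcoeffZ.
    by rewrite Z0 mulr0 addr0 big1 // => j _; rewrite /= mcoeffZ Y0 mulr0.
  move/rowP/(_ i): xM; rewrite -[x]hsubmxK mul_row_col !mxE => xMi.
  rewrite -[RHS]xMi; congr (_ + _).
    by apply: eq_bigr => j _; rewrite /= mcoeffZ !mxE.
  by rewrite big_ord1 !mxE.
have /row_freeP [B MB] := Mfree.
(* [B] is a right inverse of [M]: along the line spanned by [x] the linear parts of [Y j0] and
   [Z j0] are 1 and those of the other [Y j] are 0. The quadratic coefficient of the relation would
   then be 1. *)
pose x := B *m (delta_mx (lshift 1 j0) 0 + delta_mx (rshift t 0) 0 : 'cV_(t + 1)).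
have Mx : M *m x = delta_mx (lshift 1 j0) 0 + delta_mx (rshift t 0) 0.
  by rewrite mulmxA MB mul1mx.
pose line (P : {mpoly F[r]}) := pline (fun=> 0) (fun i => x i 0) P.
have line1 P : (line P)`_1 = (lin P *m x) 0 0.
  by rewrite pline0_coef1 [RHS]mxE; apply: eq_bigr => i _; rewrite [lin P _ _]mxE mulrC.
have lineY j : (line (Y j))`_1 = (j == j0)%:R.
  rewrite line1; have -> : lin (Y j) = row (lshift 1 j) M.
    by apply/rowP => i; rewrite !mxE (unsplitK (inl j)) !mxE.
  by rewrite -row_mul mxE Mx !mxE eqxx !andbT eq_lshift eq_lrshift addr0.
have lineZ : (line (Z j0))`_1 = 1.
  rewrite line1; have -> : lin (Z j0) = row (rshift t 0) M.
    by apply/rowP => i; rewrite !mxE (unsplitK (inr 0)) !mxE.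
  by rewrite -row_mul mxE Mx !mxE eqxx !andbT eq_rlshift eq_rshift eqxx add0r.
have YZ : \sum_j Y j * Z j = 0.
  apply: gi; rewrite raddf_sum -[RHS]yf; apply: eq_bigr => j _.
  by rewrite Yy Zf /= rmorphM.
have := congr1 (fun P => (line P)`_2) YZ; rewrite /line raddf0 coef0 raddf_sum.
rewrite coef_sum (bigD1 j0) //= big1 => [|j jj0].
  rewrite plineM coefM !big_ord_recr big_ord0 /= !pline0_coef0 Y0 Z0.
  rewrite -!/(line _) lineY lineZ eqxx mul0r mulr0 mulr1 !add0r !addr0 => /eqP.
  by rewrite oner_eq0.
rewrite plineM coefM !big_ord_recr big_ord0 /= !pline0_coef0 Y0 Z0.
by rewrite -!/(line _) lineY (negPf jj0) !mul0r mulr0 !addr0.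
Qed.

End PolynomialRing.

(** * Points of the dual and the coadjoint action *)

Lemma mxtrace_mul_delta (R : nzSemiRingType) a b (A : 'M[R]_(a, b)) i j :
  \tr (A *m delta_mx i j) = A j i.
Proof.
rewrite /mxtrace (bigD1 j) //= big1 ?addr0 => [|c cj].
  rewrite mxE (bigD1 i) //= mxE !eqxx mulr1 big1 ?addr0 // => c ci.
  by rewrite mxE (negPf ci) mulr0.
by rewrite mxE big1 // => d _; rewrite mxE (negPf cj) andbF mulr0.
Qed.

Section Points.
Variables (F : numFieldType) (n' m k : nat).
Local Notation n := n'.+1.
Local Notation N := (qdim n m k).
Local Notation lst := (ord_max : 'I_n).
Implicit Types (P : {mpoly F[N]}) (x y : qel F n m k) (t : qidx n m k).

(* (A, v, xi) is the functional (B, eta, w) |-> tr (A B) + tr (v eta) + tr (xi w);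
   adding a scalar to A does not change its values on q. *)
Definition qpt : Type := 'M[F]_n * 'M[F]_(n, m) * 'M[F]_(k, n).
Implicit Types (p q : qpt).

Definition pairing p y : F :=
  \tr (p.1.1 *m y.1.1) + \tr (p.1.2 *m y.1.2) + \tr (p.2 *m y.2).

Definition ptc p (i : 'I_N) : F := pairing p (qbasis F (enum_val i)).

(** The transpose of [qbr x] for the pairing, hence the coadjoint action up to sign; its first
    component matters modulo scalars only. *)
Definition coact x p : qpt :=
  (p.1.1 *m x.1.1 - x.1.1 *m p.1.1 + p.1.2 *m x.1.2 - x.2 *m p.2,
   - (x.1.1 *m p.1.2), p.2 *m x.1.1).

Lemma pairing_qbr p x y : pairing p (qbr x y) = pairing (coact x p) y.
Proof.
case: p x y => [[A v] xi] [[a e] w] [[b e'] w']; rewrite /pairing /=.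
rewrite !mulmxBr !mulmxBl !mulmxDl !mulNmx !raddfB !raddfD !raddfN /= !mulmxA.
rewrite [\tr (A *m b *m a)]mxtrace_mulC mulmxA.
rewrite [\tr (v *m e' *m a)]mxtrace_mulC mulmxA.
rewrite [\tr (xi *m b *m w)]mxtrace_mulC mulmxA.
ring.
Qed.

Lemma pairing_sl p (u : {u : 'I_n * 'I_n | notlast u}) :
  pairing p (qbasis F (inl (inl u))) =
  p.1.1 (val u).2 (val u).1 - ((val u).1 == (val u).2)%:R * p.1.1 lst lst.
Proof.
case: u => -[i j] /= hij; rewrite /pairing /= !mulmx0 !raddf0 !addr0.
have [<-{j hij}|ij] := eqVneq i j.
  have -> : \matrix_(r, c) (((r == i) && (c == i))%:R -
      ((r == n' :> nat) && (c == n' :> nat))%:R) = delta_mx i i - delta_mx lst lst :> 'M[F]_n.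
    by apply/matrixP => r c; rewrite !mxE.
  by rewrite mulmxBr raddfB /= !mxtrace_mul_delta mul1r.
have -> : Ediag F i j = delta_mx i j by apply/matrixP => r c; rewrite !mxE.
by rewrite mxtrace_mul_delta mul0r subr0.
Qed.

Lemma pairing_covec p (a : 'I_m) (j : 'I_n) :
  pairing p (qbasis F (inl (inr (a, j)))) = p.1.2 j a.
Proof.
rewrite /pairing /= !mulmx0 !raddf0 !addr0 add0r.
have -> : \matrix_(r, c) ((r == a) && (c == j))%:R = delta_mx a j :> 'M[F]_(m, n).
  by apply/matrixP => r c; rewrite !mxE.
by rewrite mxtrace_mul_delta.
Qed.

Lemma pairing_vec p (j : 'I_n) (b : 'I_k) :
  pairing p (qbasis F (inr (j, b))) = p.2 b j.
Proof.
rewrite /pairing /= !mulmx0 !raddf0 !add0r.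
have -> : \matrix_(r, c) ((r == j) && (c == b))%:R = delta_mx j b :> 'M[F]_(n, k).
  by apply/matrixP => r c; rewrite !mxE.
by rewrite mxtrace_mul_delta.
Qed.

Lemma mxtrace_mul (a b : nat) (A : 'M[F]_(a, b)) (B : 'M[F]_(b, a)) :
  \tr (A *m B) = \sum_(u : 'I_b * 'I_a) B u.1 u.2 * A u.2 u.1.
Proof.
rewrite -(pair_bigA _ (fun i j => B i j * A j i)) exchange_big /=.
apply: eq_bigr => i _; rewrite mxE; apply: eq_bigr => j _.
by rewrite mulrC.
Qed.

Lemma sum_notlast (G : 'I_n * 'I_n -> F) :
  \sum_(u : {u : 'I_n * 'I_n | notlast u}) G (val u) = \sum_u G u - G (lst, lst).
Proof.
rewrite -(big_sub_cond (@notlast n) predT) /=.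
rewrite [X in _ = X - _](bigD1 (lst, lst)) //= addrC addrK.
apply: eq_bigl => -[i j]; rewrite andbT unfold_in /= /notlast /=.
by rewrite xpair_eqE.
Qed.

Lemma pairing_expand p y : in_q y ->
  pairing p y = \sum_t qcoord y t * pairing p (qbasis F t).
Proof.
rewrite /in_q => y0; rewrite !big_sumType /=.
have -> : \sum_(u : {u : 'I_n * 'I_n | notlast u})
    y.1.1 (val u).1 (val u).2 * pairing p (qbasis F (inl (inl u))) = \tr (p.1.1 *m y.1.1).
  under eq_bigr do rewrite pairing_sl.
  rewrite (sum_notlast (fun u => y.1.1 u.1 u.2 *
    (p.1.1 u.2 u.1 - (u.1 == u.2)%:R * p.1.1 lst lst))) /= eqxx mul1r subrr mulr0 subr0.
  (* The diagonal basis elements carry the term -E_ll at the last index l; together these terms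
     contribute a multiple of the trace of [y], which is zero. *)
  transitivity (\tr (p.1.1 *m y.1.1) - \tr y.1.1 * p.1.1 lst lst); last first.
    by rewrite y0 mul0r subr0.
  under eq_bigr do rewrite mulrBr.
  rewrite sumrB mxtrace_mul; congr (_ - _); rewrite mulr_suml.
  rewrite -(pair_bigA _ (fun i j => y.1.1 i j * ((i == j)%:R * p.1.1 lst lst))) /=.
  apply: eq_bigr => i _; rewrite (bigD1 i) //= eqxx mul1r big1 ?addr0 // => j ji.
  by rewrite eq_sym (negPf ji) mul0r mulr0.
rewrite [LHS]/pairing; congr (_ + _ + _); rewrite mxtrace_mul; apply: eq_bigr => -[i j] _ /=.
  by rewrite pairing_covec.
by rewrite pairing_vec.
Qed.

Lemma in_q_qbr x y : in_q (qbr x y).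
Proof. by rewrite /in_q /= raddfB /= mxtrace_mulC subrr. Qed.

Definition adv x (i : 'I_N) : {mpoly F[N]} := qlin (qbr x (qbasis F (enum_val i))).

Lemma adSE x P : adS x P = vfield (adv x) P.
Proof.
rewrite /adS (reindex (fun i : 'I_N => enum_val i)) /=; last exact/onW_bij/enum_val_bij.
by apply: eq_bigr => i _; rewrite enum_valK.
Qed.

Lemma meval_qlin p y : in_q y -> (qlin y : {mpoly F[N]}).@[ptc p] = pairing p y.
Proof.
move=> yq; rewrite (pairing_expand _ yq) /qlin raddf_sum; apply: eq_bigr => t _ /=.
by rewrite mevalZ mevalXU /ptc enum_rankK.
Qed.

Lemma dird_qlin p y : in_q y -> dird (ptc p) (qlin y : {mpoly F[N]}) = (pairing p y)%:MP.
Proof.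
move=> yq; rewrite (pairing_expand _ yq) /qlin !raddf_sum; apply: eq_bigr => t _ /=.
by rewrite dirdZ dirdE vfieldX /ptc enum_rankK mpolyCM mul_mpolyC.
Qed.

(** With S(q) read as functions on q^*, ad x is the linear vector field whose value at [p] is
    [coact x p]. *)
Lemma adS_eval x p P : (adS x P).@[ptc p] = (dird (ptc (coact x p)) P).@[ptc p].
Proof.
rewrite adSE meval_vfield; congr (_.@[_]); apply: eq_dird => i.
by rewrite /adv (meval_qlin _ (in_q_qbr _ _)) pairing_qbr.
Qed.

(** The source of the hypothesis E D = D E + C of [iter_commutator_nilpotent]: the commutator is the
    constant field in the direction [coact x p]. *)
Lemma dird_adS p x P :
  dird (ptc p) (adS x P) = adS x (dird (ptc p) P) + dird (ptc (coact x p)) P.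
Proof.
rewrite !adSE dird_vfield; congr (_ + _); rewrite dirdE; apply: eq_vfield => i.
by rewrite /adv (dird_qlin _ (in_q_qbr _ _)) pairing_qbr.
Qed.

Lemma ptc_surj (v : 'I_N -> F) : exists p, p.1.1 lst lst = 0 /\ ptc p =1 v.
Proof.
have lstF : @notlast n (lst, lst) = false by rewrite /notlast /= eqxx.
pose w t := v (enum_rank t).
(* The pairing is tr (A B), so entry (i, j) of A is the coordinate of the basis element at (j, i);
   the omitted index (lst, lst) receives the default 0. *)
exists (\matrix_(i, j) oapp (fun u => w (inl (inl u))) 0 (insub (j, i)),
  \matrix_(j, a) w (inl (inr (a, j))), \matrix_(b, j) w (inr (j, b))); split.
  by rewrite mxE (insubF _ lstF).
move=> i; rewrite /ptc -[i in RHS]enum_valK; case: (enum_val i) => [[u|[a j]]|[j b]].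
- rewrite pairing_sl /= !mxE (insubF _ lstF) mulr0 subr0 /=.
  by rewrite -surjective_pairing valK.
- by rewrite pairing_covec mxE.
- by rewrite pairing_vec mxE.
Qed.

Lemma ptcD p q (t : F) : (fun i => ptc p i + ptc q i * t) =1
  ptc (p.1.1 + t *: q.1.1, p.1.2 + t *: q.1.2, p.2 + t *: q.2).
Proof.
move=> i; rewrite /ptc /pairing /= !mulmxDl !mxtraceD -!scalemxAl !mxtraceZ.
ring.
Qed.

End Points.

(** * Invariants *)

Section Invariants.
Variables (F : numFieldType) (n' m k : nat).
Local Notation n := n'.+1.
Local Notation N := (qdim n m k).
Local Notation qpt := (qpt F n' m k).
Implicit Types (P : {mpoly F[N]}) (x y : qel F n m k) (t : qidx n m k) (p q : qpt).

Lemma poly_deriv0 (f : {poly F}) : f^`() = 0 -> f = (f`_0)%:P.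
Proof.
move=> f0; apply/polyP => -[|i]; rewrite coefC //=.
have := congr1 (fun g : {poly F} => g`_i) f0.
rewrite coef_deriv coef0 => /eqP; rewrite -mulr_natr mulf_eq0 pnatr_eq0 orbF.
by move/eqP.
Qed.

(** Integrates the action of the abelian ideal: (0, X, -Y) moves A with constant velocity v X + Y xi
    and fixes v and xi, so an invariant has zero derivative along this line. *)
Lemma invariant_translate P (A : 'M[F]_n) v xi (X : 'M[F]_(m, n)) (Y : 'M[F]_(n, k)) :
  q_invariant P ->
  P.@[ptc (A + v *m X + Y *m xi, v, xi)] = P.@[ptc (A, v, xi)].
Proof.
move=> Pinv; pose dA := v *m X + Y *m xi.
pose g := pline (ptc (A, v, xi)) (ptc (dA, 0, 0)) P.
have gE (s : F) : g.[s] = P.@[ptc (A + s *: dA, v, xi)].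
  rewrite horner_pline; apply: meval_eq => i; rewrite ptcD /=.
  by rewrite !scaler0 !addr0.
have : g^`() = 0.
  apply: poly_fun0 => s; rewrite deriv_pline horner_pline.
  pose pt : qpt := (A + s *: dA, v, xi).
  transitivity (adS (0, X, - Y) P).@[ptc pt]; last by rewrite Pinv ?meval0 // /in_q raddf0.
  rewrite adS_eval; have -> : coact (0, X, - Y) pt = (dA, 0, 0).
    by rewrite /coact /= !mulmx0 !mul0mx subrr oppr0 add0r mulNmx opprK.
  by apply: meval_eq => i; rewrite ptcD /= !scaler0 !addr0.
move/poly_deriv0 => gC.
have := gE 1; rewrite scale1r /dA addrA => <-.
have := gE 0; rewrite scale0r addr0 => <-.
by rewrite gC !hornerC.
Qed.

(* None: coordinates of A; Some None: of v; Some (Some b): of the b-th row of xi. *)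
Definition qclass t : option (option 'I_k) :=
  match t with
  | inl (inl _) => None
  | inl (inr _) => Some None
  | inr (_, b) => Some (Some b)
  end.

Definition qweight : Type := {ffun option 'I_k -> int}.
HB.instance Definition _ := GRing.Zmodule.on qweight.

Definition wunit (c : option 'I_k) : qweight := [ffun d => (d == c)%:Z].

Definition tweight t : qweight := oapp wunit 0 (qclass t).

Definition iweight (i : 'I_N) : qweight := tweight (enum_val i).

Lemma whom_qlin w y : (forall t, qcoord y t != 0 -> tweight t = w) ->
  whom iweight w (qlin y : {mpoly F[N]}).
Proof.
move=> yw; apply: whom_sum => t _.
have [->|/yw <-] := eqVneq (qcoord y t) 0; first by rewrite scale0r; apply: whom0.
apply: whomZ; have -> : tweight t = iweight (enum_rank t) by rewrite /iweight enum_rankK.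
exact: whomXU.
Qed.

Lemma mul_delta_col (a : 'M[F]_n) j (b : 'I_k) r c :
  (a *m (\matrix_(r, c) ((r == j) && (c == b))%:R : 'M[F]_(n, k))) r c != 0 -> c = b.
Proof.
apply: contraNeq => cb; rewrite mxE big1 // => i _.
by rewrite mxE (negPf cb) andbF mulr0.
Qed.

Lemma adv_sl (a : 'M[F]_n) i : whom iweight (iweight i + 0) (adv (a, 0, 0) i).
Proof.
rewrite addr0; apply: whom_qlin => t; rewrite /iweight.
case: (enum_val i) => [[u|[a' j]]|[j b]]; case: t => [[u'|[a'' j']]|[j' b']] //=;
  rewrite ?mul0mx ?mulmx0 ?subrr ?subr0 ?sub0r ?oppr0 //; try by rewrite mxE eqxx.
by move/mul_delta_col->.
Qed.

Lemma adv_covec (e : 'M[F]_(m, n)) i :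
  whom iweight (iweight i + wunit None) (adv (0, e, 0) i).
Proof.
apply: whom_qlin => t; rewrite /iweight.
case: (enum_val i) => [[u|[a' j]]|[j b]]; case: t => [[u'|[a'' j']]|[j' b']] //=;
  rewrite ?mul0mx ?mulmx0 ?subrr ?subr0 ?sub0r ?oppr0 //; try by rewrite mxE eqxx.
by rewrite /tweight /= add0r.
Qed.

Lemma adv_vec (w : 'M[F]_(n, k)) c i : (forall j b, b != c -> w j b = 0) ->
  whom iweight (iweight i + wunit (Some c)) (adv (0, 0, w) i).
Proof.
move=> wc; apply: whom_qlin => t; rewrite /iweight.
case: (enum_val i) => [[u|[a' j]]|[j b]]; case: t => [[u'|[a'' j']]|[j' b']] //=;
  rewrite ?mul0mx ?mulmx0 ?subrr ?subr0 ?sub0r ?oppr0 //; try by rewrite mxE eqxx.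
rewrite mxE oppr_eq0 => h; rewrite /tweight /= add0r.
suff -> : b' = c by [].
apply/eqP; apply: contraNT h => b'c.
by rewrite mxE big1 // => l _; rewrite wc // mulr0.
Qed.

Lemma adS_split (a : 'M[F]_n) e w P :
  adS (a, e, w) P = adS (a, 0, 0) P + adS (0, e, 0) P +
    \sum_c adS (0, 0, w *m delta_mx c c) P.
Proof.
rewrite !adSE (eq_bigr _ (fun c _ => adSE _ _)) /vfield exchange_big /= -!big_split /=.
apply: eq_bigr => i _; rewrite -mulr_sumr -!mulrDr; congr (_ * _).
rewrite /adv /qlin exchange_big -!big_split /=; apply: eq_bigr => t _.
rewrite -scaler_suml -!scalerDl; congr (_ *: _).
case: (qbasis F (enum_val i)) => -[b1 b2] b3; case: t => [[u|[a' j]]|[j b]] /=.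
- rewrite !mul0mx !mulmx0 subrr [X in _ = _ + X + _]mxE addr0 big1 ?addr0 // => c _.
  by rewrite mxE.
- rewrite mul0mx !mulmx0 subr0 sub0r big1 ?addr0 => [|c _]; last first.
    by rewrite subrr mxE.
  by rewrite mxE [RHS]addrC [X in _ + X]mxE mxE.
- rewrite !mul0mx !mulmx0 subr0 subrr [X in _ = _ + X + _]mxE addr0.
  transitivity ((a *m b3) j b + (\sum_c - (b1 *m (w *m delta_mx c c))) j b).
    rewrite sumrN -!mulmx_sumr; have -> : \sum_c delta_mx c c = 1%:M :> 'M[F]_k.
      apply/matrixP => c d; rewrite summxE (bigD1 c) //= !mxE eqxx /= eq_sym.
      by rewrite big1 ?addr0 // => c' c'c; rewrite mxE eq_sym (negPf c'c).
    by rewrite mulmx1 !mxE.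
  by rewrite summxE; congr (_ + _); apply: eq_bigr => c _; rewrite sub0r.
Qed.

(** A general ad x does not shift weights by a constant, but its pieces do: sl_n by 0, the covectors
    by the unit weight of v, and the b-th copy of vectors by that of row b. Each piece lies in q and
    kills the components separately. *)
Lemma wcomp_invariant w P : q_invariant P -> q_invariant (wcomp iweight w P).
Proof.
move=> Pinv [[a e] v] aq; rewrite adS_split.
have -> : adS (a, 0, 0) (wcomp iweight w P) = 0.
  by rewrite adSE (wcomp_vfield _ _ (@adv_sl a)) -adSE Pinv ?raddf0.
have -> : adS (0, e, 0) (wcomp iweight w P) = 0.
  by rewrite adSE (wcomp_vfield _ _ (@adv_covec e)) -adSE Pinv ?raddf0 // /in_q raddf0.
rewrite big1 ?addr0 // => c _.
have vc j b : b != c -> (v *m delta_mx c c) j b = 0.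
  move=> bc; rewrite mxE big1 // => l _; rewrite mxE.
  by rewrite (negPf bc) andbF mulr0.
rewrite adSE (wcomp_vfield _ _ (fun i => @adv_vec _ _ i vc)) -adSE Pinv ?raddf0 //.
by rewrite /in_q raddf0.
Qed.

Lemma q_invariantC c : q_invariant (c%:MP : {mpoly F[N]}).
Proof. by move=> x _; rewrite adSE vfieldC. Qed.

Lemma q_invariantD P Q : q_invariant P -> q_invariant Q -> q_invariant (P + Q).
Proof. by move=> hP hQ x xq; rewrite adSE raddfD /= -!adSE hP // hQ // addr0. Qed.

Lemma q_invariantM P Q : q_invariant P -> q_invariant Q -> q_invariant (P * Q).
Proof. by move=> hP hQ x xq; rewrite adSE vfieldM -!adSE hP // hQ // mul0r mulr0 addr0. Qed.

Lemma q_invariant_closed : alg_closed (@q_invariant F n m k).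
Proof. by split; [exact: q_invariantC|exact: q_invariantD|exact: q_invariantM]. Qed.

(** The bound is strict so that e = 0 leaves only the zero polynomial, the base case in
    [iter_dird_rank1]. *)
Definition vec_degree_lt b (e : nat) P :=
  forall mu, P@_mu != 0 -> mwt iweight mu (Some b) < e%:Z.

Lemma dird_vec_degree b (c : 'rV[F]_n) (e : nat) P :
  vec_degree_lt b e.+1 P -> vec_degree_lt b e (dird (ptc (0, 0, delta_mx b 0 *m c)) P).
Proof.
move=> Pe mu; rewrite /dird raddf_sum /= => h.
have [i hi] : exists i, (ptc (0, 0, delta_mx b 0 *m c) i *: P^`M(i))@_mu != 0.
  apply/existsP; apply: contraR h; rewrite negb_exists => /forallP h.
  by rewrite big1 // => i _; apply/eqP; move: (h i); rewrite negbK.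
move: hi; rewrite mcoeffZ mulf_eq0 negb_or mcoeff_deriv -mulr_natr mulf_eq0 negb_or.
move=> /and3P[ci /Pe + _]; rewrite mwtD mwtU ffunE.
suff -> : iweight i (Some b) = 1 by rewrite -[e.+1]addn1 PoszD ltrD2r.
move: ci; rewrite /ptc /iweight; case: (enum_val i) => [[u|[a j]]|[j b']].
- by rewrite pairing_sl /= !mxE mulr0 subr0 eqxx.
- by rewrite pairing_covec mxE eqxx.
- rewrite pairing_vec mxE big_ord1 mxE /tweight /= ffunE.
  by rewrite eqxx andbT; case: (eqVneq b' b) => [->|]; rewrite ?eqxx // mul0r eqxx.
Qed.

Lemma mwt_iweight_ge0 mu c : 0 <= mwt iweight mu c.
Proof.
rewrite /mwt sum_ffunE; apply: sumr_ge0 => i _; rewrite ffunMnE mulrn_wge0 //.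
by rewrite /iweight /tweight; case: (qclass _) => [d|] /=; rewrite ffunE.
Qed.

Lemma vec_degree_lt0 b P : vec_degree_lt b 0 P -> P = 0.
Proof.
move=> P0; apply/mpolyP => mu; rewrite mcoeff0; apply/eqP.
by apply: contraT => /P0; rewrite ltNge mwt_iweight_ge0.
Qed.

Lemma adS_additive x : additive (@adS F n m k x).
Proof. by move=> P Q; rewrite !adSE raddfB. Qed.
HB.instance Definition _ x :=
  GRing.isAdditive.Build {mpoly F[N]} {mpoly F[N]} (@adS F n m k x) (adS_additive x).

(** Take for E the derivative of row b of xi along c, and for D the action of the vector -u in the
    b-th copy. Their commutator C is the derivative of A along u c and commutes with both; D kills
    [P], and E kills it after e steps. *)
Lemma iter_dird_rank1 b (e : nat) P (u : 'cV[F]_n) (c : 'rV[F]_n) :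
  q_invariant P -> vec_degree_lt b e P ->
  iter e (dird (ptc (u *m c, 0, 0))) P = 0.
Proof.
move=> Pinv Pe; pose x : qel F n m k := (0, 0, - (u *m delta_mx 0 b)).
have xc : coact x (0, 0, delta_mx b 0 *m c) = (u *m c, 0, 0).
  rewrite /coact /= !mulmx0 subrr oppr0 add0r mulNmx opprK.
  rewrite mulmxA -[u *m _ *m _]mulmxA mul_delta_mx.
  have -> : delta_mx 0 0 = 1%:M :> 'M[F]_1 by apply/matrixP => i j; rewrite !ord1 !mxE.
  by rewrite add0r mulmx1.
have xx : coact x (u *m c, 0, 0) = (0, 0, 0).
  by rewrite /coact /= !(mulmx0, mul0mx) !(subrr, addr0, oppr0).
have d0 Q : dird (ptc (0, 0, 0)) Q = 0.
  by rewrite /dird big1 // => i _; rewrite /ptc /pairing !mul0mx !raddf0 !addr0 scale0r.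
pose E : {additive {mpoly F[N]} -> {mpoly F[N]}} := dird (ptc (0, 0, delta_mx b 0 *m c)).
pose D : {additive {mpoly F[N]} -> {mpoly F[N]}} := adS x.
pose C : {additive {mpoly F[N]} -> {mpoly F[N]}} := dird (ptc (u *m c, 0, 0)).
apply: (@iter_commutator_nilpotent F {mpoly F[N]} E D C).
- by move=> Q; rewrite [LHS]dird_adS xc.
- by move=> Q; apply: dirdC.
- by move=> Q; rewrite [LHS]dird_adS xx d0 addr0.
- by apply: Pinv; rewrite /in_q raddf0.
elim: e P {Pinv} Pe => [|e IH] P Pe; first exact: vec_degree_lt0 Pe.
by rewrite iterSr; apply/IH/dird_vec_degree.
Qed.

(** The r rank one directions commute, and each has degree at most e on [P]. The degrees add up, so
    r e + 1 derivatives suffice. *)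
Lemma iter_dird_rank b (e : nat) P r (U : 'M[F]_(n, r)) (V : 'M[F]_(r, n)) :
  q_invariant P -> vec_degree_lt b e.+1 P ->
  iter (r * e).+1 (dird (ptc (U *m V, 0, 0))) P = 0.
Proof.
move=> Pinv Pe; have -> : U *m V = \sum_(j < r) col j U *m row j V.
  apply/matrixP => i j; rewrite mxE summxE; apply: eq_bigr => l _.
  by rewrite mxE big_ord1 !mxE.
rewrite -[r in (r * e).+1]size_enum_ord -[\sum_(_ < r) _]big_enum /=.
elim: (enum 'I_r) => [|j s IH] /=.
  rewrite big_nil /dird big1 // => i _.
  by rewrite /ptc /pairing !mul0mx !raddf0 !addr0 scale0r.
rewrite mulSn big_cons.
set M1 := col j U *m row j V; set M2 := \sum_(_ <- s) _ in IH *.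
have H := @iter_add_nilpotent _ (dird (ptc (M1, 0, 0))) (dird (ptc (M2, 0, 0)))
  (@dirdC _ _ _ _) e (size s * e) P (iter_dird_rank1 _ _ Pinv Pe) IH.
have DD (Q : {mpoly F[N]}) : dird (ptc (M1 + M2, 0, 0)) Q =
    dird (ptc (M1, 0, 0)) Q + dird (ptc (M2, 0, 0)) Q.
  rewrite -dirdD; apply: eq_dird => i.
  by rewrite -[ptc (M2, 0, 0) i]mulr1 ptcD /= scale1r !scaler0 !addr0.
rewrite -[LHS]/(iter (e + size s * e).+1 (dird (ptc (M1 + M2, 0, 0))) P).
by rewrite (eq_iter DD); exact: H.
Qed.

End Invariants.

(** * The degree bound *)

Section Degrees.
Variables (F : numFieldType) (n' m k : nat).
Local Notation n := n'.+1.
Local Notation N := (qdim n m k).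
Local Notation lst := (ord_max : 'I_n).
Local Notation qpt := (qpt F n' m k).
Local Notation iwt := (@iweight n' m k).
Implicit Types (P : {mpoly F[N]}) (x y : qel F n m k) (t : qidx n m k) (p q : qpt).

(** Eigenvalue of diag(s) on the basis element [t]. The values lie in any [zmodType] because integer
    weights are compared with eigenvalues in [F]. *)
Definition lam (V : zmodType) (s : 'I_n -> V) t : V :=
  match t with
  | inl (inl u) => s (val u).1 - s (val u).2
  | inl (inr (_, j)) => - s j
  | inr (j, _) => s j
  end.

(** The quantity deg_v - sum_b beta_b; by [sum_lam_delta] it is minus the weight under the identity
    matrix. *)
Definition wdef (w : qweight k) : int := w None - \sum_b w (Some b).

Lemma adv_diag (s : 'I_n -> F) i :
  adv (diag_mx (\row_j s j), 0, 0) i = lam s (enum_val i) *: 'X_i :> {mpoly F[N]}.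
Proof.
apply/eqP; rewrite -subr_eq0; apply/eqP/mpoly_fun0 => v.
have [p [_ pv]] := ptc_surj v; rewrite -(meval_eq _ pv) mevalB mevalZ mevalXU.
rewrite /adv (meval_qlin _ (in_q_qbr _ _)) pairing_qbr /ptc.
apply/eqP; rewrite subr_eq0; apply/eqP.
case: (enum_val i) => [[u|[a j]]|[j b]].
- rewrite !pairing_sl /= mulmx0 mul0mx subr0 addr0 mul_mx_diag mul_diag_mx !mxE.
  have [->|_] := eqVneq (val u).1 (val u).2; rewrite /=; ring.
- by rewrite !pairing_covec /= mul_diag_mx !mxE mulNr.
- by rewrite !pairing_vec /= mul_mx_diag !mxE mulrC.
Qed.

Lemma sum_lam_delta t :
  \sum_(i < n) lam (fun j => (j == i)%:Z) t = - wdef (tweight t).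
Proof.
rewrite /wdef /tweight; case: t => [[u|[a j]]|[j b]] /=; rewrite ?ffunE.
- rewrite sumrB (bigD1 (val u).1) //= eqxx big1 => [|i /negPf ni]; last by rewrite eq_sym ni.
  rewrite (bigD1 (val u).2) //= eqxx big1 => [|i /negPf ni]; last by rewrite eq_sym ni.
  by rewrite subrr big1 ?subr0 ?oppr0 // => b _; rewrite ffunE.
- rewrite sumrN (bigD1 j) //= eqxx big1 => [|i /negPf ni]; last by rewrite eq_sym ni.
  by rewrite big1 ?subr0 // => b _; rewrite ffunE.
- rewrite (bigD1 j) //= eqxx big1 => [|i /negPf ni]; last by rewrite eq_sym ni.
  rewrite (bigD1 b) //= ffunE eqxx big1 ?addr0 ?sub0r ?opprK // => c' c'b.
  by rewrite ffunE (inj_eq Some_inj) (negPf c'b).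
Qed.

Lemma wdef_mwt mu : wdef (mwt iwt mu) = \sum_i wdef (tweight (enum_val i)) *+ mu i.
Proof.
rewrite /wdef /mwt sum_ffunE.
under [X in _ - X]eq_bigr do rewrite sum_ffunE.
rewrite exchange_big /= -sumrB; apply: eq_bigr => i _.
rewrite ffunMnE mulrnBl; congr (_ - _); rewrite -sumrMnl.
by apply: eq_bigr => b _; rewrite ffunMnE.
Qed.

(** The traceless matrices E_ii - E_ll kill [P], so one monomial of [P] has the same integer weight
    under all E_ii. These n equal weights add up to minus [wdef w]. *)
Lemma wdef_dvd w P : q_invariant P -> whom iwt w P -> P != 0 ->
  exists z, wdef w = n%:Z * z.
Proof.
move=> Pinv Pw Pn0; have muP := mlead_supp Pn0.
move: muP; rewrite mcoeff_msupp; move: (mlead P) => mu Pmu.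
pose S i : int := \sum_l lam (fun j : 'I_n => (j == i)%:Z) (enum_val l : qidx n m k) *+ mu l.
have Seq i : S i = S lst.
  apply/eqP; rewrite -subr_eq0; apply/eqP.
  pose s (j : 'I_n) : F := (j == i)%:R - (j == lst)%:R.
  have xq : in_q ((diag_mx (\row_j s j), 0, 0) : qel F n m k).
    rewrite /in_q mxtrace_diag /=; under eq_bigr do rewrite mxE.
    by rewrite sumrB (bigD1 i) //= (bigD1 lst (F := fun j => (j == lst)%:R)) //= !eqxx !big1
      ?subrr // => j /negPf->.
  have := Pinv _ xq; rewrite adSE (eq_vfield _ (adv_diag s)) => /(congr1 (mcoeff mu)).
  rewrite mcoeff_euler mcoeff0 => /eqP; rewrite mulf_eq0 (negPf Pmu) orbF => /eqP h.
  apply/eqP; rewrite -(intr_eq0 F) -h /S -sumrB rmorph_sum /=; apply/eqP/eq_bigr => l _.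
  rewrite -mulrnBl raddfMn /= mulr_natr; congr (_ *+ _).
  by case: (enum_val l) => [[u|[a j]]|[j b]] /=;
    rewrite /s ?rmorphB ?rmorphN /= ?rmorphB ?rmorphN /= ?rmorph_nat; ring.
exists (- S lst); rewrite -(Pw _ Pmu) wdef_mwt mulrN.
rewrite -natz mulr_natl; have <- : \sum_(i < n) S i = S lst *+ n.
  by rewrite (eq_bigr _ (fun i _ => Seq i)) sumr_const card_ord.
rewrite /S exchange_big -sumrN; apply: eq_bigr => l _ /=.
by rewrite sumrMnl sum_lam_delta mulNrn opprK.
Qed.

Lemma euler_wdef w P p : whom iwt w P ->
  (dird (ptc (0, p.1.2, - p.2)) P).@[ptc p] = (wdef w)%:~R * P.@[ptc p].
Proof.
move=> Pw; pose e (i : 'I_N) : F := (wdef (tweight (enum_val i)))%:~R.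
have -> : (dird (ptc (0, p.1.2, - p.2)) P).@[ptc p] =
    (vfield (fun i => e i *: 'X_i) P).@[ptc p].
  rewrite meval_vfield; congr (_.@[_]); apply: eq_dird => i.
  rewrite mevalZ mevalXU /e /ptc /wdef /tweight.
  case: (enum_val i) => [[u|[a j]]|[j b]] /=.
  - rewrite pairing_sl /= !mxE mulr0 subr0 big1 => [|b _]; rewrite ?ffunE //.
    by rewrite subr0 mul0r.
  - rewrite !pairing_covec /= ffunE eqxx big1 => [|b _]; rewrite ?ffunE //.
    by rewrite subr0 mul1r.
  - rewrite !pairing_vec /= ffunE mxE (bigD1 b) //= ffunE eqxx big1.
      by rewrite addr0 sub0r mulN1r.
    by move=> c' c'b; rewrite ffunE (inj_eq Some_inj) (negPf c'b).
rewrite -mevalZ; congr (_.@[_]); apply/mpolyP => mu; rewrite mcoeff_euler mcoeffZ.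
have [->|Pmu] := eqVneq P@_mu 0; first by rewrite !mulr0.
congr (_ * _); rewrite -(Pw _ Pmu) wdef_mwt rmorph_sum; apply: eq_bigr => i _ /=.
by rewrite rmorphMn /= mulr_natr.
Qed.

Definition Mv : 'M[{mpoly F[N]}]_(n, m) := \matrix_(j, a) qvar F (inl (inr (a, j))).
Definition Mx : 'M[{mpoly F[N]}]_(k, n) := \matrix_(b, j) qvar F (inr (j, b)).

Lemma meval_Mv p : map_mx (meval (ptc p)) Mv = p.1.2.
Proof.
by apply/matrixP => j a; rewrite !mxE mevalXU /ptc enum_rankK pairing_covec.
Qed.

Lemma meval_Mx p : map_mx (meval (ptc p)) Mx = p.2.
Proof.
by apply/matrixP => j a; rewrite !mxE mevalXU /ptc enum_rankK pairing_vec.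
Qed.

Lemma size_derivn0 (f : {poly F}) s : f^`(s) = 0 -> (size f <= s)%N.
Proof.
move=> f0; rewrite leqNgt; apply/negP => sf.
have := congr1 (fun g : {poly F} => g`_((size f).-1 - s)) f0.
have s1 : (s <= (size f).-1)%N by rewrite -ltnS prednK // (leq_ltn_trans _ sf).
rewrite coef_derivn coef0 subnKC // => /eqP.
rewrite -mulr_natr mulf_eq0 pnatr_eq0 -leqn0 leqNgt ffact_gt0 s1 orbF.
by rewrite -[_`__]/(lead_coef f) lead_coef_eq0 => /eqP f00; rewrite f00 size_poly0 in sf.
Qed.

(* H := 1 - v L is idempotent of trace n - m with H v = 0 and xi H = 0, and A may be
   replaced by A1 = H A. On the line C2 + t C through A1 modulo Y xi, the action of H
   is the Euler field in t, which makes the invariant homogeneous in t. *)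
Lemma invariant_at_generic w P b e p :
  q_invariant P -> whom iwt w P -> w (Some b) <= e%:Z ->
  forall (L0 : 'M[F]_(m, n)) (R0 : 'M[F]_(m, k)),
  L0 *m p.1.2 = 1%:M -> p.2 *m p.1.2 *m R0 = 1%:M ->
  P.@[ptc p] != 0 ->
  exists2 j, (j <= (m - k) * e)%N & (n * j)%:Z = wdef w * (n%:Z - m%:Z).
Proof.
case: p => [[A v] xi] /= Pinv Pw we L0 R0 L0v YR0 Pp.
have [Y EY] : {Y : 'M[F]_(k, m) | Y = xi *m v} by exists (xi *m v).
(* Corrects the left inverse [L0] of v so that also Y L = xi; this is what makes xi H = 0. *)
rewrite -EY in YR0; pose L := L0 + R0 *m (xi - Y *m L0).
have Lv : L *m v = 1%:M.
  by rewrite mulmxDl L0v -mulmxA mulmxBl -[Y *m _ *m _]mulmxA L0v mulmx1 EY subrr mulmx0 addr0.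
have YL : Y *m L = xi.
  by rewrite mulmxDr mulmxA YR0 mul1mx addrC subrK.
pose H : 'M[F]_n := 1%:M - v *m L.
have Hv : H *m v = 0 by rewrite mulmxBl mul1mx -mulmxA Lv mulmx1 subrr.
have xiH : xi *m H = 0 by rewrite mulmxBr mulmx1 mulmxA -EY YL subrr.
have LH : L *m H = 0 by rewrite mulmxBr mulmx1 mulmxA Lv mul1mx subrr.
have HH : H *m H = H by rewrite {1}/H mulmxBl mul1mx -mulmxA LH mulmx0 subr0.
have trH : \tr H = n%:R - m%:R.
  by rewrite raddfB /= mxtrace1 mxtrace_mulC Lv mxtrace1.
pose A1 := H *m A; have HA1 : H *m A1 = A1 by rewrite mulmxA HH.
have PA1 : P.@[ptc (A1, v, xi)] = P.@[ptc (A, v, xi)].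
  rewrite -(invariant_translate A1 v xi (L *m A) 0 Pinv) mul0mx addr0 mulmxA -mulmxDl.
  by rewrite subrK mul1mx.
(* Since Y R0 = 1, one has Y K = 0 and rank K <= m - k, which bounds the rank of C. As A1 = A1 H +
   A1 v L and Y L = xi, the point C2 + C is A1 - (A1 v R0) xi, where the invariant takes the same
   value as at A1. *)
clearbody A1; pose K := 1%:M - R0 *m Y.
pose C := A1 *m v *m K *m L; pose C2 := A1 *m H.
have PC : P.@[ptc (C2 + C, v, xi)] != 0.
  rewrite -PA1 in Pp; rewrite -(invariant_translate A1 v xi 0 (- (A1 *m v *m R0)) Pinv) in Pp.
  suff -> : C2 + C = A1 + v *m 0 + - (A1 *m v *m R0) *m xi by [].
  rewrite mulmx0 addr0 /C2 /C /H /K !(mulmxBr, mulmxBl) !mulmx1 !mulNmx !mulmxA.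
  by rewrite -[A1 *m v *m R0 *m Y *m L]mulmxA YL addrA subrK.
have CE : C = A1 *m v *m col_base K *m (row_base K *m L).
  by rewrite /C -{1}(mulmx_base K) !mulmxA.
have HC2 : H *m C2 = C2 by rewrite mulmxA HA1.
have HC : H *m C = C by rewrite /C !mulmxA HA1.
have C2H : C2 *m H = C2 by rewrite -mulmxA HH.
have CH : C *m H = 0 by rewrite -mulmxA LH mulmx0.
clearbody H C C2.
pose g := pline (ptc (C2, v, xi)) (ptc (C, 0, 0)) P.
pose pt s : qpt := (C2 + s *: C, v, xi).
have gE s : g.[s] = P.@[ptc (pt s)].
  by rewrite horner_pline; apply: meval_eq => i; rewrite ptcD /= !scaler0 !addr0.
have gE' s : g^`().[s] = (dird (ptc (C, 0, 0)) P).@[ptc (pt s)].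
  rewrite deriv_pline horner_pline; apply: meval_eq => i.
  by rewrite ptcD /= !scaler0 !addr0.
(* n c is the trace of H, so H - c lies in sl_n; the correction c acts on v and xi through
   [euler_wdef]. *)
pose c : F := (n%:R - m%:R) / n%:R.
have n0 : n%:R != 0 :> F by rewrite pnatr_eq0.
(* Euler's equation: g is a multiple of a single power t^j, with j = c (wdef w). *)
have gode : 'X * g^`() = (c * (wdef w)%:~R) *: g.
  apply/eqP; rewrite -subr_eq0; apply/eqP/poly_fun0 => s.
  rewrite !hornerE gE gE'.
  have xq : in_q ((H - c%:M, 0, 0) : qel F n m k).
    by rewrite /in_q /= raddfB /= mxtrace_scalar trH -[c *+ _]mulr_natr /c divfK // subrr.
  have := congr1 (meval (ptc (pt s))) (Pinv _ xq); rewrite adS_eval meval0.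
  have -> : coact (H - c%:M, 0, 0) (pt s) = (- s *: C, c *: v, - (c *: xi)).
    rewrite /coact /= !mulmx0 !mul0mx subr0 addr0; congr (_, _, _).
    - rewrite mulmxBr mulmxBl scalar_mxC opprB addrA subrK.
      rewrite mulmxDl mulmxDr -scalemxAl -scalemxAr C2H CH HC2 HC scaler0 addr0.
      by rewrite opprD addrA subrr sub0r scaleNr.
    - by rewrite mulmxBl Hv sub0r opprK mul_scalar_mx.
    - by rewrite mulmxBr xiH sub0r mul_mx_scalar.
  have -> : (dird (ptc (- s *: C, c *: v, - (c *: xi))) P).@[ptc (pt s)] =
     - s * (dird (ptc (C, 0, 0)) P).@[ptc (pt s)] +
     c * (dird (ptc (0, v, - xi)) P).@[ptc (pt s)].
    rewrite -!mevalZ -mevalD /dird; congr (_.@[_]); rewrite !scaler_sumr -big_split.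
    apply: eq_bigr => i _ /=; rewrite !scalerA -scalerDl; congr (_ *: _).
    rewrite /ptc /pairing /= -scalerN -!scalemxAl !mul0mx !mxtraceZ !mxtrace0; ring.
  rewrite (@euler_wdef w P (pt s)) // => h.
  by rewrite -[RHS]oppr0 -[in RHS]h; ring.
have gn0 : g != 0.
  by apply: contraNneq PC => g0; have := gE 1; rewrite g0 horner0 /pt scale1r => <-.
pose j := (size g).-1.
have jg : g`_j != 0 by rewrite -[g`_j]/(lead_coef g) lead_coef_eq0.
have jE : j%:R = c * (wdef w)%:~R :> F.
  have := congr1 (fun f : {poly F} => f`_j) gode; rewrite coefXM coefZ.
  case: j jg => [|j] jg /=.
    by move/esym/eqP; rewrite mulf_eq0 (negPf jg) orbF => /eqP->.
  by rewrite coef_deriv => h; apply: (mulIf jg); rewrite mulr_natl.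
exists j; last first.
  move: jE; move: (wdef w) => W jE; apply/eqP.
  rewrite -(eqr_int F) PoszM !rmorphM rmorphB /= -!pmulrn jE /c.
  by rewrite mulrA [_ * (_ / _)]mulrC divfK // mulrC.
have rK : (\rank K <= m - k)%N.
  have rY : (k <= \rank Y)%N.
    by apply: (@mulmx1_min_rank _ _ _ _ _ 1%:M R0); rewrite mul1mx.
  have /mulmx0_rank_max : Y *m K = 0 by rewrite mulmxBr mulmx1 mulmxA YR0 mul1mx subrr.
  by move=> h; rewrite leq_subRL ?(leq_trans rY) ?rank_leq_col // (leq_trans _ h) ?leq_add2r.
apply: leq_trans (leq_mul rK (leqnn e)).
have Pe : vec_degree_lt b e.+1 P.
  by move=> mu /Pw ->; rewrite (le_lt_trans we) // ltz_nat.
have := iter_dird_rank (A1 *m v *m col_base K) (row_base K *m L) Pinv Pe.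
rewrite -CE => h; rewrite /j -ltnS prednK ?size_poly_gt0 //.
apply: size_derivn0.
have derivE s : g^`(s) = pline (ptc (C2, v, xi)) (ptc (C, 0, 0))
    (iter s (dird (ptc (C, 0, 0))) P).
  by elim: s => [|s IH]; rewrite ?derivn0 // derivnS IH deriv_pline.
by rewrite derivE h raddf0.
Qed.

End Degrees.

(** * The degree bound for nonzero invariants, and vanishing products *)

Section Indecomposable.
Variables (F : numFieldType) (n' m k : nat).
Local Notation n := n'.+1.
Local Notation N := (qdim n m k).
Local Notation lst := (ord_max : 'I_n).
Local Notation qpt := (qpt F n' m k).
Local Notation iwt := (@iweight n' m k).
Local Notation Mv := (Mv F n' m k).
Local Notation Mx := (Mx F n' m k).
Implicit Types (P : {mpoly F[N]}) (w : qweight k).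

Definition std_v : 'M[F]_(n, m) := \matrix_(i, j) (i == j :> nat)%:R.
Definition std_xi : 'M[F]_(k, n) := \matrix_(i, j) (i == j :> nat)%:R.

(** The inverses required by [invariant_at_generic] exist where two minors are nonzero. So the
    product of [P] with these minors vanishes at every point, and neither minor is zero because both
    equal 1 at the standard point. *)
Lemma invariant_eq0 w P b e : (k <= m)%N -> (m <= n)%N ->
  q_invariant P -> whom iwt w P -> w (Some b) <= e%:Z ->
  (forall j, (j <= (m - k) * e)%N -> (n * j)%:Z != wdef w * (n%:Z - m%:Z)) -> P = 0.
Proof.
move=> km mn Pinv Pw we nj.
pose T := rowsub (widen_ord mn) Mv; pose Yk := colsub (widen_ord km) (Mx *m Mv).
have PQ : P * \det T * \det Yk = 0.
  apply: mpoly_fun0 => v; have [p [_ pv]] := ptc_surj v; rewrite -(meval_eq _ pv).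
  rewrite !mevalM -!det_map_mx !map_mxsub map_mxM meval_Mv meval_Mx.
  apply/eqP; apply: contraT; rewrite !mulf_eq0 !negb_or => /andP[/andP[Pp Tp] Yp].
  have Tu : rowsub (widen_ord mn) p.1.2 \in unitmx by rewrite unitmxE unitfE.
  have Yu : colsub (widen_ord km) (p.2 *m p.1.2) \in unitmx by rewrite unitmxE unitfE.
  have [||j jle /eqP] := invariant_at_generic Pinv Pw we
    (L0 := invmx (rowsub (widen_ord mn) p.1.2) *m rowsub (widen_ord mn) 1%:M)
    (R0 := colsub (widen_ord km) 1%:M *m invmx (colsub (widen_ord km) (p.2 *m p.1.2)))
    _ _ Pp.
  - by rewrite -mulmxA mul_rowsub_mx mul1mx mulVmx.
  - by rewrite mulmxA mulmx_colsub mulmx1 mulmxV.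
  - by rewrite (negPf (nj _ jle)).
pose p0 : qpt := (0, std_v, std_xi).
have vE : rowsub (widen_ord mn) std_v = 1%:M.
  by apply/matrixP => i j; rewrite !mxE.
have YE : colsub (widen_ord km) (std_xi *m std_v) = 1%:M.
  apply/matrixP => i j; rewrite !mxE.
  rewrite (bigD1 (widen_ord mn (widen_ord km i))) //= big1 ?addr0 => [|l li].
    by rewrite !mxE /= eqxx mul1r.
  rewrite !mxE; case: eqP => [il|]; last by rewrite mul0r.
  by case/eqP: li; apply/val_inj.
move/eqP: PQ; rewrite !mulf_eq0 -orbA => /or3P[/eqP//|/eqP d0|/eqP d0]; exfalso.
  have := congr1 (meval (ptc p0)) d0; rewrite meval0 -det_map_mx map_mxsub meval_Mv /= vE.
  by rewrite det1 => /eqP; rewrite oner_eq0.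
have := congr1 (meval (ptc p0)) d0.
rewrite meval0 -det_map_mx map_mxsub map_mxM meval_Mv meval_Mx /= YE.
by rewrite det1 => /eqP; rewrite oner_eq0.
Qed.

(** With no degree in row [b0] of xi, the rank one bound holds with exponent 1: the derivatives
    along all elementary matrices in A vanish. Those in v and xi vanish by weight. *)
Lemma invariant_const w P (b0 : 'I_k) :
  q_invariant P -> whom iwt w P -> P@_0 = 0 ->
  w None = 0 -> (forall b, w (Some b) = 0) -> P = 0.
Proof.
move=> Pinv Pw P0 w0 wb.
suff dP i : P^`M(i) = 0 by rewrite (mderiv0_const dP) P0 mpolyC0.
have dclass c : iwt i c = 1 -> w c = 0 -> P^`M(i) = 0.
  move=> ic wc; apply/mpolyP => mu; rewrite mcoeff0; apply/eqP; apply: contraT.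
  move/(whom_mderiv Pw); move/ffunP/(_ c); rewrite !ffunE ic wc => h.
  by have := mwt_iweight_ge0 mu c; rewrite h.
move: dclass; rewrite /iweight; case Ei : (enum_val i) => [[u|[a j]]|[j b]]; last 2 first.
- by move=> /(_ None); apply; rewrite // /tweight /= ffunE.
- by move=> /(_ (Some b)); apply; rewrite ?wb // /tweight /= ffunE eqxx.
(* The transposed elementary matrix is the direction dual to coordinate [u]: its last diagonal entry
   is 0, so no other coordinate sees it. *)
move=> _; pose c : 'rV[F]_n := delta_mx 0 (val u).1.
have Pe : vec_degree_lt b0 1 P by move=> mu /Pw ->; rewrite wb.
have := iter_dird_rank1 (delta_mx (val u).2 0) c Pinv Pe.
rewrite /c mul_delta_mx /= => <-; rewrite /dird (bigD1 i) //= big1 ?addr0 => [|l li].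
  have ul : ((lst == (val u).2) && (lst == (val u).1)) = false.
    by case: u {Ei c} => -[u1 u2] /= hu; apply/negbTE; move: hu; rewrite /notlast /= andbC
      ![lst == _]eq_sym.
  by rewrite /ptc Ei pairing_sl /= !mxE !eqxx ul /= mulr0 subr0 scale1r.
suff -> : ptc ((delta_mx (val u).2 (val u).1, 0, 0) : qpt) l = 0 by rewrite scale0r.
rewrite /ptc; case El : (enum_val l) => [[u'|[a j]]|[j b]]; last 2 first.
- by rewrite pairing_covec mxE.
- by rewrite pairing_vec mxE.
have ul : ((lst == (val u).2) && (lst == (val u).1)) = false.
  by case: u {Ei c} => -[u1 u2] /= hu; apply/negbTE; move: hu; rewrite /notlast /= andbC
    ![lst == _]eq_sym.
rewrite pairing_sl /= !mxE ul mulr0 subr0; case: andP => // -[/eqP e2 /eqP e1].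
case/eqP: li; apply: enum_val_inj; rewrite El Ei; congr (inl (inl _)); apply: val_inj.
by rewrite [LHS]surjective_pairing [RHS]surjective_pairing; congr (_, _).
Qed.

Lemma whom_neq0_ge0 w P : whom iwt w P -> P != 0 -> forall c, 0 <= w c.
Proof.
move=> Pw /mlead_supp; rewrite mcoeff_msupp => /Pw <- c; exact: mwt_iweight_ge0.
Qed.

Lemma wdefD w w' : wdef (w + w') = wdef w + wdef w'.
Proof.
rewrite /wdef ffunE; under eq_bigr do rewrite ffunE.
by rewrite big_split /=; ring.
Qed.

Lemma wdef0 w : (forall b, w (Some b) = 0) -> wdef w = w None.
Proof. by move=> w0; rewrite /wdef big1 ?subr0. Qed.

Lemma wdef_le0_eq0 w P (b0 : 'I_k) :
  q_invariant P -> whom iwt w P -> P@_0 = 0 ->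
  wdef w <= 0 -> (forall b, w (Some b) <= 0) -> P = 0.
Proof.
move=> Pinv Pw P0 w0 wb; apply/eqP; apply: contraT => Pn0.
have wge := whom_neq0_ge0 Pw Pn0.
have wb0 b : w (Some b) = 0 by apply/le_anti; rewrite wb wge.
have wN : w None = 0.
  by apply/eqP; rewrite eq_le wge andbT -(wdef0 wb0).
by rewrite (invariant_const b0 Pinv Pw P0 wN wb0) eqxx in Pn0.
Qed.

(** For z >= 1 the degree on the generic line would be z (n - m) >= n - m, beyond the bound (m - k)
    e. *)
Lemma vec_weight_ge w P b e z : (k <= m)%N -> (m <= n)%N -> ((m - k) * e < n - m)%N ->
  q_invariant P -> whom iwt w P -> P != 0 ->
  wdef w = n%:Z * z -> 1 <= z -> e%:Z < w (Some b).
Proof.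
move=> km mn de Pinv Pw Pn0 wz z1; rewrite ltNge; apply: contra_neqN Pn0 => we.
apply: (invariant_eq0 km mn Pinv Pw we) => j je.
rewrite wz PoszM -mulrA (inj_eq (mulfI _)) //.
have nm : n%:Z - m%:Z = (n - m)%N%:Z by rewrite subzn.
rewrite nm; apply/eqP => jz.
have : (n - m)%N%:Z <= j%:Z by rewrite jz ler_peMl.
by rewrite lez_nat; move/(leq_ltn_trans)/(_ (leq_ltn_trans je de)); rewrite ltnn.
Qed.

Lemma product_eq0 (b0 : 'I_k) e w P Q a a' :
  (k <= m)%N -> (m <= n)%N -> ((m - k) * e < n - m)%N ->
  q_invariant P -> q_invariant Q -> whom iwt a P -> whom iwt a' Q ->
  P@_0 = 0 -> Q@_0 = 0 -> a + a' = w ->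
  wdef w = n -> (forall b, w (Some b) = e.+1) -> P * Q = 0.
Proof.
move=> km mn de.
wlog az : P Q a a' / n%:Z <= wdef a => [H|] Pinv Qinv Pa Qa P0 Q0 aw wn wb.
  apply/eqP; rewrite mulf_eq0; apply: contraT; rewrite negb_or => /andP[Pn0 Qn0].
  have [z az] := wdef_dvd Pinv Pa Pn0; have [z' az'] := wdef_dvd Qinv Qa Qn0.
  have : wdef a + wdef a' = n by rewrite -wdefD aw.
  rewrite az az' -mulrDr => /eqP; rewrite -[X in _ == X]mulr1 (inj_eq (mulfI _)) // => /eqP zz.
  have [z1|z1] := leP 1 z.
    suff /eqP : P * Q = 0 by rewrite mulf_eq0 (negPf Pn0) (negPf Qn0).
    by apply: (H P Q a a'); rewrite // az ler_peMr.
  suff /eqP : Q * P = 0 by rewrite mulf_eq0 (negPf Pn0) (negPf Qn0).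
  by apply: (H Q P a' a); rewrite // ?[a' + a]addrC // az' ler_peMr //; lia.
apply/eqP; rewrite mulf_eq0; apply: contraT; rewrite negb_or => /andP[Pn0 Qn0].
have [z azE] := wdef_dvd Pinv Pa Pn0.
have z1 : 1 <= z.
  by move: az; rewrite azE -[X in X <= _]mulr1 ler_pM2l.
case/eqP: Qn0; apply: (wdef_le0_eq0 b0 Qinv Qa Q0) => [|b].
  have -> : wdef a' = n%:Z - wdef a by rewrite -wn -aw wdefD addrAC subrr add0r.
  by rewrite subr_le0.
have := vec_weight_ge b km mn de Pinv Pa Pn0 azE z1.
have := wb b; rewrite -aw ffunE; move: (a _ : int) (a' _ : int) => c d; lia.
Qed.

(** One factor has no degree in xi and degree at most 1 in v. As n > 1 divides its [wdef], it
    depends on A alone, so it is constant, hence zero. *)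
Lemma product_pairing_eq0 (b0 : 'I_k) P Q a a' : (1 < n)%N ->
  q_invariant P -> q_invariant Q -> whom iwt a P -> whom iwt a' Q ->
  P@_0 = 0 -> Q@_0 = 0 -> a + a' = wunit None + wunit (Some b0) -> P * Q = 0.
Proof.
move=> n1.
wlog az : P Q a a' / a (Some b0) = 0 => [H|] Pinv Qinv Pa Qa P0 Q0 aw.
  apply/eqP; rewrite mulf_eq0; apply: contraT; rewrite negb_or => /andP[Pn0 Qn0].
  have := whom_neq0_ge0 Pa Pn0 (Some b0); have := whom_neq0_ge0 Qa Qn0 (Some b0).
  have := congr1 (fun w : qweight k => w (Some b0)) aw; rewrite !ffunE eqxx /=.
  have [a0|a0] := eqVneq (a (Some b0)) 0.
    by have /eqP := H P Q a a' a0 Pinv Qinv Pa Qa P0 Q0 aw; rewrite mulf_eq0 (negPf Pn0) (negPf Qn0).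
  move=> s h h'; have a'0 : a' (Some b0) = 0.
    by move: s h h' a0; move: (a _ : int) (a' _ : int) => c d; lia.
  suff /eqP : Q * P = 0 by rewrite mulf_eq0 (negPf Pn0) (negPf Qn0).
  by apply: (H Q P a' a); rewrite // addrC.
apply/eqP; rewrite mulf_eq0; apply: contraT; rewrite negb_or => /andP[Pn0 Qn0].
have ge0 := whom_neq0_ge0 Pa Pn0; have ge0' := whom_neq0_ge0 Qa Qn0.
have aE c : a c + a' c = (c == None)%:Z + (c == Some b0)%:Z.
  by have := congr1 (fun w : qweight k => w c) aw; rewrite !ffunE.
have ab b : a (Some b) = 0.
  have [->//|bb0] := eqVneq b b0.
  have := aE (Some b); rewrite (inj_eq Some_inj) (negPf bb0) /=.
  have := ge0 (Some b); have := ge0' (Some b).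
  by move: (a _ : int) (a' _ : int) => c d; lia.
have [z azE] := wdef_dvd Pinv Pa Pn0.
case/eqP: Pn0; apply: (wdef_le0_eq0 b0 Pinv Pa P0) => [|b]; last by rewrite ab.
have aN1 : wdef a <= 1.
  rewrite (wdef0 ab); have := aE None; have := ge0' None; rewrite /=.
  by move: (a _ : int) (a' _ : int) => c d; lia.
rewrite leNgt; apply/negP; rewrite azE pmulr_rgt0 // => z0.
have : n%:Z * 1 <= n%:Z * z by rewrite ler_pM2l.
by move/le_trans; rewrite -azE mulr1 => /(_ _ aN1); rewrite lez_nat leqNgt n1.
Qed.

End Indecomposable.

(** * The Sylvester minors *)

Section BlockDeterminant.
Variables (S : comNzRingType) (n m k c q : nat) (cm : (c <= m)%N).
Variables (MA : 'M[S]_n) (MV : 'M[S]_(n, m)) (MX : 'M[S]_(k, n)).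

(* Rows E_0, ..., E_(q+1) (of size n), X_1, ..., X_(q+1) (of size k) and a last row;
   columns z_1, ..., z_(q+1) (of size n), u_0, ..., u_q (of size m) and u_(q+1)
   restricted to its first c coordinates. The linear forms are
     E_i : A z_(i+1) - z_i + v u_i,   X_i : xi z_i,   last : rho u_(q+1)
   with z_0 = z_(q+2) = 0; the indices of X and z are shifted by one below. *)
Definition brow : finType := ('I_q.+2 * 'I_n + 'I_q.+1 * 'I_k + 'I_1)%type.
Definition bcol : finType := ('I_q.+1 * 'I_n + 'I_q.+1 * 'I_m + 'I_c)%type.

Definition gEZ (i j : nat) : 'M[S]_n := (i == j)%:R *: MA - (i == j.+1)%:R%:M.
Definition gEU (i j : nat) : 'M[S]_(n, m) := (i == j)%:R *: MV.
Definition gET (i : nat) : 'M[S]_(n, c) := (i == q.+1)%:R *: colsub (widen_ord cm) MV.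
Definition gXZ (i j : nat) : 'M[S]_(k, n) := (i == j)%:R *: MX.

Definition bent (rho : 'I_c -> S) (x : brow) (y : bcol) : S :=
  match x, y with
  | inl (inl (i, l)), inl (inl (j, l')) => gEZ i j l l'
  | inl (inl (i, l)), inl (inr (j, a)) => gEU i j l a
  | inl (inl (i, l)), inr a => gET i l a
  | inl (inr (i, b)), inl (inl (j, l')) => gXZ i j b l'
  | inr _, inr a => rho a
  | _, _ => 0
  end.

Variables (D : {additive S -> S}).
Hypothesis DM : forall x y, D (x * y) = D x * y + x * D y.
Variables (a : 'M[S]_n) (e : 'M[S]_(m, n)) (w : 'M[S]_(n, k)) (ka : S).
Hypothesis DA : map_mx D MA = MA *m a - a *m MA + MV *m e - w *m MX + ka%:M.
Hypothesis DV : map_mx D MV = - (a *m MV).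
Hypothesis DX : map_mx D MX = MX *m a.

(* The infinitesimal action on the matrix is a row operation plus a column operation;
   the shift of A by ka is undone as in the binomial expansion of (A + ka)^i. *)
Definition lEE (i i' : nat) : 'M[S]_n :=
  - ((i == i')%:R *: a) - ((i.+1 == i')%:R * (ka * i.+1%:R))%:M.
Definition lEX (i i' : nat) : 'M[S]_(n, k) := - ((i == i')%:R *: w).
Definition lXX (i i' : nat) : 'M[S]_k := - ((i.+1 == i')%:R * (ka * i.+1%:R))%:M.
Definition cZZ (j j' : nat) : 'M[S]_n :=
  (j' == j)%:R *: a + ((j' == j.+1)%:R * (ka * j.+1%:R))%:M.
Definition cUZ (j j' : nat) : 'M[S]_(m, n) := (j' == j)%:R *: e.
Definition cUU (j j' : nat) : 'M[S]_m := ((j' == j.+1)%:R * (ka * j.+1%:R))%:M.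
Definition cUT (j : nat) : 'M[S]_(m, c) :=
  (q == j)%:R *: ((ka * q.+1%:R) *: colsub (widen_ord cm) 1%:M).

Definition brow_op (x x' : brow) : S :=
  match x, x' with
  | inl (inl (i, l)), inl (inl (i', l')) => lEE i i' l l'
  | inl (inl (i, l)), inl (inr (i', b)) => lEX i i' l b
  | inl (inr (i, b)), inl (inr (i', b')) => lXX i i' b b'
  | _, _ => 0
  end.

Definition bcol_op (y y' : bcol) : S :=
  match y, y' with
  | inl (inl (j, l)), inl (inl (j', l')) => cZZ j j' l l'
  | inl (inr (j, b)), inl (inl (j', l')) => cUZ j j' b l'
  | inl (inr (j, b)), inl (inr (j', b')) => cUU j j' b b'
  | inl (inr (j, b)), inr b' => cUT j b b'
  | _, _ => 0
  end.

Lemma sum_delta (V : lmodType S) p (i0 : nat) (G : nat -> V) :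
  \sum_(i < p) (i0 == i)%:R *: G i = (i0 < p)%:R *: G i0.
Proof.
case: ltnP => [ip|pi].
  rewrite (bigD1 (Ordinal ip)) //= eqxx big1 ?addr0 // => i ii0.
  by rewrite eq_sym -val_eqE /= in ii0; rewrite (negPf ii0) scale0r.
rewrite scale0r big1 // => i _; case: eqP => [ii|]; last by rewrite scale0r.
by have := ltn_ord i; rewrite -ii ltnNge pi.
Qed.

Lemma sum_deltaS (V : lmodType S) p (i0 : nat) (G : nat -> V) :
  \sum_(i < p) (i0 == i.+1)%:R *: G i = ((0 < i0)%N && (i0 <= p)%N)%:R *: G i0.-1.
Proof.
case: i0 => [|i0]; last by rewrite -(sum_delta p i0 G).
by rewrite scale0r big1 // => i _; rewrite scale0r.
Qed.

Lemma derivation_nat (b : bool) x : D (b%:R * x) = b%:R * D x.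
Proof. by case: b; rewrite ?mul1r // !mul0r raddf0. Qed.

Lemma derivation_bool (b : bool) : D b%:R = 0.
Proof. by case: b; rewrite ?raddf0 // derivation1. Qed.

Lemma map_scale_bool p p' (b : bool) (M : 'M[S]_(p, p')) :
  map_mx D (b%:R *: M) = b%:R *: map_mx D M.
Proof. by apply/matrixP => i j; rewrite !mxE derivation_nat. Qed.

Lemma derivation_gEZ (i j : nat) : (i < q.+2)%N -> (j < q.+1)%N ->
  map_mx D (gEZ i j) =
  \sum_(i' < q.+2) lEE i i' *m gEZ i' j + \sum_(i' < q.+1) lEX i i' *m gXZ i' j +
  (\sum_(j' < q.+1) gEZ i j' *m cZZ j' j + \sum_(j' < q.+1) gEU i j' *m cUZ j' j).
Proof.
move=> iq jq.
have -> : \sum_(i' < q.+2) lEE i i' *m gEZ i' j =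
    - (a *m gEZ i j) - (i < q.+1)%:R *: ((ka * i.+1%:R) *: gEZ i.+1 j).
  under eq_bigr do rewrite mulmxBl mulNmx -scalemxAl mul_scalar_mx -scalerA.
  rewrite sumrB sumrN (sum_delta q.+2 i (fun i' => a *m gEZ i' j)) iq scale1r.
  by rewrite (sum_delta q.+2 i.+1 (fun i' => _ *: gEZ i' j)).
have -> : \sum_(i' < q.+1) lEX i i' *m gXZ i' j = - ((i < q.+1)%:R *: (w *m gXZ i j)).
  under eq_bigr do rewrite mulNmx -scalemxAl.
  by rewrite sumrN (sum_delta q.+1 i (fun i' => w *m gXZ i' j)).
have -> : \sum_(j' < q.+1) gEZ i j' *m cZZ j' j =
    gEZ i j *m a + (ka * j%:R) *: gEZ i j.-1.
  under eq_bigr do rewrite mulmxDr -scalemxAr mul_mx_scalar -scalerA.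
  rewrite big_split /= (sum_delta q.+1 j (fun j' => gEZ i j' *m a)) jq scale1r.
  rewrite (sum_deltaS q.+1 j (fun j' => (ka * j'.+1%:R) *: gEZ i j')) (ltnW jq) andbT.
  by case: j {jq} => [|j] /=; rewrite ?scale1r // mulr0 !scale0r.
have -> : \sum_(j' < q.+1) gEU i j' *m cUZ j' j = gEU i j *m e.
  under eq_bigr do rewrite -scalemxAr.
  by rewrite (sum_delta q.+1 j (fun j' => gEU i j' *m e)) jq scale1r.
have -> : map_mx D (gEZ i j) = (i == j)%:R *: map_mx D MA.
  rewrite -map_scale_bool; apply/matrixP => l l'; rewrite !mxE raddfB /= -[X in _ = X]subr0.
  by congr (_ - _); rewrite (raddfMn D) derivation_bool mul0rn.
have -> : gEZ i.+1 j = (i.+1 == j)%:R *: MA - (i == j)%:R%:M by rewrite /gEZ eqSS.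
have -> : (ka * j%:R) *: gEZ i j.-1 =
    (ka * j%:R) *: ((i.+1 == j)%:R *: MA - (i == j)%:R%:M).
  by rewrite /gEZ; case: j {jq} => [|j] /=; rewrite ?eqSS // mulr0 !scale0r.
rewrite DA /gEZ /gXZ /gEU mulmxBr mulmxBl mul_scalar_mx mul_mx_scalar.
rewrite -!scalemxAr -!scalemxAl.
move: (a *m MA) (MA *m a) (MV *m e) (w *m MX) => m1 m2 m3 m4.
(* For i = j the two shifts contribute (i + 1) ka - i ka = ka, the scalar in [DA]; for i + 1 = j
   they give opposite multiples of [MA]. *)
have [ij|ij] := eqVneq i j.
  rewrite -{}ij in jq *; rewrite jq [i == i.+1]ltn_eqF // [i.+1 == i]gtn_eqF //.
  by apply/matrixP => l l'; rewrite !mxE -natr1 /=; case: (l == l') => /=; ring.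
have [ij1|ij1] := eqVneq i j.+1.
  rewrite ij1 [j.+2 == j]gtn_eqF; last by rewrite ltnS leqnSn.
  by apply/matrixP => l l'; rewrite !mxE /=; case: (l == l') => /=; ring.
have [i1j|i1j] := eqVneq i.+1 j.
  have -> : (i < q.+1)%N by rewrite i1j ltnW.
  by rewrite -i1j; apply/matrixP => l l'; rewrite !mxE /=; case: (l == l') => /=; ring.
by apply/matrixP => l l'; rewrite !mxE /=; case: (l == l') => /=; ring.
Qed.

Lemma derivation_gEU (i j : nat) : (i < q.+2)%N -> (j < q.+1)%N ->
  map_mx D (gEU i j) = \sum_(i' < q.+2) lEE i i' *m gEU i' j +
  \sum_(j' < q.+1) gEU i j' *m cUU j' j.
Proof.
move=> iq jq.
under eq_bigr do rewrite mulmxBl mulNmx -scalemxAl mul_scalar_mx -scalerA.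
rewrite sumrB sumrN (sum_delta q.+2 i (fun i' => a *m gEU i' j)) iq scale1r.
rewrite (sum_delta q.+2 i.+1 (fun i' => _ *: gEU i' j)).
under eq_bigr do rewrite mul_mx_scalar -scalerA.
rewrite (sum_deltaS q.+1 j (fun j' => (ka * j'.+1%:R) *: gEU i j')) (ltnW jq) andbT.
rewrite /gEU map_scale_bool DV -scalemxAr scalerN -addrA -[LHS]addr0; congr (_ + _).
case: j jq => [|j] jq /=; first by rewrite !scale0r !scaler0 ?(subrr, oppr0, addr0).
rewrite eqSS scale1r; case: (eqVneq i j) => [->|_]; last by rewrite !scale0r !scaler0 ?(subrr, oppr0, addr0).
by rewrite ltnS ltnW // scale1r addNr.
Qed.

Lemma derivation_gET (i : nat) : (i < q.+2)%N ->
  map_mx D (gET i) = \sum_(i' < q.+2) lEE i i' *m gET i' +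
  \sum_(j' < q.+1) gEU i j' *m cUT j'.
Proof.
move=> iq; under eq_bigr do rewrite mulmxBl mulNmx -scalemxAl mul_scalar_mx -scalerA.
rewrite sumrB sumrN (sum_delta q.+2 i (fun i' => a *m gET i')) iq scale1r.
rewrite (sum_delta q.+2 i.+1 (fun i' => _ *: gET i')).
under eq_bigr do rewrite -scalemxAr.
rewrite (sum_delta q.+1 q (fun j' => gEU i j' *m (_ *: _))) ltnSn scale1r.
have -> : gEU i q *m ((ka * q.+1%:R) *: colsub (widen_ord cm) 1%:M) =
    (i == q)%:R *: ((ka * q.+1%:R) *: colsub (widen_ord cm) MV).
  by rewrite /gEU -scalemxAr -scalemxAl mulmx_colsub mulmx1 !scalerA [in LHS]mulrC.
rewrite /gET map_scale_bool map_mxsub DV -scalemxAr mulmx_colsub -addrA -[LHS]addr0; congr (_ + _).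
  by rewrite -scalerN; congr (_ *: _); apply/matrixP => l l'; rewrite !mxE.
rewrite eqSS; case: (eqVneq i q) => [->|_]; last by rewrite !scale0r !scaler0 ?(subrr, oppr0, addr0).
by rewrite ltnSn !scale1r addNr.
Qed.

Lemma derivation_gXZ (i j : nat) : (i < q.+1)%N -> (j < q.+1)%N ->
  map_mx D (gXZ i j) = \sum_(i' < q.+1) lXX i i' *m gXZ i' j +
  \sum_(j' < q.+1) gXZ i j' *m cZZ j' j.
Proof.
move=> iq jq; under eq_bigr do rewrite mulNmx mul_scalar_mx -scalerA.
rewrite sumrN (sum_delta q.+1 i.+1 (fun i' => _ *: gXZ i' j)).
under eq_bigr do rewrite mulmxDr -scalemxAr mul_mx_scalar -scalerA.
rewrite big_split /= (sum_delta q.+1 j (fun j' => gXZ i j' *m a)) jq scale1r.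
rewrite (sum_deltaS q.+1 j (fun j' => (ka * j'.+1%:R) *: gXZ i j')) (ltnW jq) andbT.
rewrite /gXZ map_scale_bool DX -scalemxAl addrCA -[LHS]addr0; congr (_ + _).
case: j jq => [|j] jq /=; first by rewrite !scale0r !scaler0 ?(subrr, oppr0, addr0).
rewrite eqSS scale1r; case: (eqVneq i j) => [->|_]; last by rewrite !scale0r !scaler0 ?(subrr, oppr0, addr0).
by rewrite jq scale1r addNr.
Qed.

Lemma block_sum p1 p2 r t (f g : 'I_p1 * 'I_p2 -> S) (M1 : nat -> 'M[S]_(r, p2))
    (M2 : nat -> 'M[S]_(p2, t)) l l' :
  (forall i z, f (i, z) = M1 i l z) -> (forall i z, g (i, z) = M2 i z l') ->
  \sum_u f u * g u = (\sum_(i < p1) M1 i *m M2 i) l l'.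
Proof.
move=> fE gE; rewrite summxE.
rewrite (eq_bigr (fun u => f (u.1, u.2) * g (u.1, u.2))) => [|[]] //.
rewrite -(pair_bigA _ (fun i z => f (i, z) * g (i, z))) /=.
by apply: eq_bigr => i _; rewrite mxE; apply: eq_bigr => z _; rewrite fE gE.
Qed.

Lemma derivation_bent rho x y : (forall b, D (rho b) = 0) ->
  D (bent rho x y) = \sum_x' brow_op x x' * bent rho x' y +
    \sum_y' bent rho x y' * bcol_op y' y.
Proof.
move=> Drho.
have mxD p p' (M1 M2 : 'M[S]_(p, p')) l l' : (M1 + M2) l l' = M1 l l' + M2 l l'.
  by rewrite mxE.
rewrite !big_sumType /=.
case: x => [[[i l]|[i b]]|z]; case: y => [[[j l']|[j a']]|a'] /=.
- transitivity (map_mx D (gEZ i j) l l'); first by rewrite [RHS]mxE.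
  rewrite derivation_gEZ // !mxD [X in _ = _ + X + _]big1 => [|u _]; last by rewrite mul0r.
  rewrite addr0 [X in _ = _ + (_ + X)]big1 => [|u _]; last by rewrite mulr0.
  by rewrite addr0; congr (_ + _ + (_ + _)); apply/esym;
    [ exact: (block_sum (M1 := lEE i) (M2 := gEZ^~ j)) | exact: (block_sum (M1 := lEX i) (M2 := gXZ^~ j))
    | exact: (block_sum (M1 := gEZ i) (M2 := cZZ^~ j)) | exact: (block_sum (M1 := gEU i) (M2 := cUZ^~ j))].
- transitivity (map_mx D (gEU i j) l a'); first by rewrite [RHS]mxE.
  rewrite derivation_gEU // !mxD [X in _ = _ + X + _]big1 => [|u _]; last by rewrite mul0r.
  rewrite addr0 [X in _ = _ + (_ + X)]big1 => [|u _]; last by rewrite mulr0.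
  rewrite addr0 [X in _ = _ + X + _]big1 => [|[u1 u2] _]; last by rewrite mulr0.
  rewrite addr0 [X in _ = _ + (X + _)]big1 => [|[u1 u2] _]; last by rewrite mulr0.
  by rewrite add0r; congr (_ + _); apply/esym;
    [ exact: (block_sum (M1 := lEE i) (M2 := gEU^~ j)) | exact: (block_sum (M1 := gEU i) (M2 := cUU^~ j))].
- transitivity (map_mx D (gET i) l a'); first by rewrite [RHS]mxE.
  rewrite derivation_gET // !mxD [X in _ = _ + X + _]big1 => [|u _]; last by rewrite mul0r.
  rewrite addr0 [X in _ = _ + (_ + X)]big1 => [|u _]; last by rewrite mulr0.
  rewrite addr0 [X in _ = _ + X + _]big1 => [|[u1 u2] _]; last by rewrite mulr0.
  rewrite addr0 [X in _ = _ + (X + _)]big1 => [|[u1 u2] _]; last by rewrite mulr0.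
  by rewrite add0r; congr (_ + _); apply/esym;
    [ exact: (block_sum (M1 := lEE i) (M2 := gET)) | exact: (block_sum (M1 := gEU i) (M2 := cUT))].
- transitivity (map_mx D (gXZ i j) b l'); first by rewrite [RHS]mxE.
  rewrite derivation_gXZ // !mxD [X in _ = _ + X + _]big1 => [|u _]; last by rewrite mul0r.
  rewrite addr0 [X in _ = _ + (_ + X)]big1 => [|u _]; last by rewrite mulr0.
  rewrite addr0 [X in _ = X + _ + _]big1 => [|[u1 u2] _]; last by rewrite mul0r.
  rewrite add0r [X in _ = _ + (_ + X)]big1 => [|[u1 u2] _]; last by rewrite mul0r.
  by rewrite addr0; congr (_ + _); apply/esym;
    [ exact: (block_sum (M1 := lXX i) (M2 := gXZ^~ j)) | exact: (block_sum (M1 := gXZ i) (M2 := cZZ^~ j))].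
- rewrite raddf0 !big1 ?addr0 // => u; rewrite ?mul0r ?mulr0 //; case: u => *;
    by rewrite ?mul0r ?mulr0.
- rewrite raddf0 !big1 ?addr0 // => u; rewrite ?mul0r ?mulr0 //; case: u => *;
    by rewrite ?mul0r ?mulr0.
- rewrite raddf0 !big1 ?addr0 // => u; rewrite ?mul0r ?mulr0 //; case: u => *;
    by rewrite ?mul0r ?mulr0.
- rewrite raddf0 !big1 ?addr0 // => u; rewrite ?mul0r ?mulr0 //; case: u => *;
    by rewrite ?mul0r ?mulr0.
- rewrite Drho !big1 ?addr0 // => u; rewrite ?mul0r ?mulr0 //; case: u => *;
    by rewrite ?mul0r ?mulr0.
Qed.

Hypothesis cardE : #|brow| = #|bcol|.

(** Both operations have trace zero: the shifts and the terms in e and w lie off the diagonal, and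
    the remaining diagonal blocks are -a or a, which are traceless. *)
Lemma derivation_bdet rho : (forall b, D (rho b) = 0) -> \tr a = 0 ->
  D (\det (fmx cardE (bent rho))) = 0.
Proof.
move=> Drho tra.
rewrite (derivation_fdet DM cardE (L := brow_op) (C := bcol_op)); last first.
  by move=> x y; apply: derivation_bent.
suff [-> ->] : \sum_x brow_op x x = 0 /\ \sum_y bcol_op y y = 0 by rewrite addr0 mul0r.
split; rewrite !big_sumType /=.
  rewrite [X in _ + X]big1 // addr0 [X in _ + X]big1 ?addr0 => [|[i b] _]; last first.
    by rewrite !mxE gtn_eqF // mul0r mul0rn oppr0.
  rewrite (eq_bigr (fun u : 'I_q.+2 * 'I_n => lEE u.1 u.1 u.2 u.2)) => [|[]] //.
  rewrite -(pair_bigA _ (fun (i : 'I_q.+2) l => lEE i i l l)) /= big1 // => i _.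
  transitivity (\sum_l - a l l); last by rewrite sumrN -[X in - X]/(\tr a) tra oppr0.
  by apply: eq_bigr => l _; rewrite !mxE eqxx gtn_eqF // mul0r mul0rn subr0 mul1r.
rewrite [X in _ + X]big1 // addr0 [X in _ + X]big1 ?addr0 => [|[i b] _]; last first.
  by rewrite !mxE ltn_eqF // mul0r mul0rn.
rewrite (eq_bigr (fun u : 'I_q.+1 * 'I_n => cZZ u.1 u.1 u.2 u.2)) => [|[]] //.
rewrite -(pair_bigA _ (fun (i : 'I_q.+1) l => cZZ i i l l)) /= big1 // => i _.
transitivity (\tr a); last exact: tra.
by apply: eq_bigr => l _; rewrite !mxE eqxx ltn_eqF // mul0r mul0rn addr0 mul1r.
Qed.

End BlockDeterminant.

Section BlockRelation.
Variables (S : comNzRingType) (n m k c q : nat) (cm : (c <= m)%N).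
Variables (MA : 'M[S]_n) (MV : 'M[S]_(n, m)) (MX : 'M[S]_(k, n)).
Hypothesis cardE : #|brow n k q| = #|bcol n m c q|.
Local Notation bent := (bent cm MA MV MX).
Local Notation bdet rho := (\det (fmx cardE (bent rho))).

Lemma bdet_linear rho : bdet rho = \sum_a rho a * bdet (fun b => (b == a)%:R).
Proof.
pose x0 : 'I_#|brow n k q| := enum_rank (inr ord0).
have x0E : enum_val x0 = inr ord0 by rewrite enum_rankK.
have cofE rho' j : cofactor (fmx cardE (bent rho)) x0 j = cofactor (fmx cardE (bent rho')) x0 j.
  rewrite /cofactor; congr (_ * \det _); apply/matrixP => i l; rewrite !mxE.
  have : enum_val (lift x0 i) != inr ord0.
    by rewrite -x0E (inj_eq enum_val_inj) eq_sym neq_lift.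
  by case: (enum_val _) => [[[? ?]|[? ?]]|z] //; rewrite (ord1 z).
rewrite (expand_det_row _ x0).
have bE y : bent rho (inr ord0) y =
    \sum_a rho a * bent (fun b => (b == a)%:R) (inr ord0) y.
  case: y => [[[j l]|[j b]]|b] /=.
  - by rewrite big1 // => u _; rewrite mulr0.
  - by rewrite big1 // => u _; rewrite mulr0.
  rewrite (bigD1 b) //= eqxx mulr1 big1 ?addr0 // => u ub.
  by rewrite eq_sym (negPf ub) mulr0.
under eq_bigr do rewrite mxE x0E bE mulr_suml.
rewrite exchange_big /=; apply: eq_bigr => a _.
rewrite (expand_det_row _ x0) mulr_sumr; apply: eq_bigr => j _.
by rewrite [fmx _ _ _ _]mxE x0E -mulrA (cofE (fun b => (b == a)%:R)).
Qed.

(* The row xi_b (v_a)_a is a combination of the rows v u - z and xi_b z. *)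
Lemma bdet_pairing (b0 : 'I_k) : bdet (fun a => (MX *m MV) b0 (widen_ord cm a)) = 0.
Proof.
set rho := fun a => _.
pose u (x : brow n k q) : S := match x with
  | inl (inl (i, l)) => (q.+1 == i)%:R * MX b0 l
  | inl (inr (i, b)) => (q == i)%:R * (b0 == b)%:R
  | inr _ => -1
  end.
have u0 y : \sum_x u x * bent rho x y = 0.
  rewrite !big_sumType /= big_ord1.
  pose r1 := row b0 MX; pose r2 : 'rV[S]_k := delta_mx 0 b0.
  have r2X : r2 *m MX = r1 by rewrite -rowE.
  have s1 p (M2 : nat -> 'M[S]_(n, p)) (g : 'I_q.+2 * 'I_n -> S) l' : (forall i z, g (i, z) = M2 i z l') ->
      \sum_(w : 'I_q.+2 * 'I_n) u (inl (inl w)) * g w = (r1 *m M2 q.+1) 0 l'.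
    move=> gE; rewrite (block_sum (M1 := fun i => (q.+1 == i)%:R *: r1) (M2 := M2) (l := 0) (l' := l')) //.
      under eq_bigr do rewrite -scalemxAl.
      by rewrite (sum_delta q.+2 q.+1 (fun i => r1 *m M2 i)) ltnSn scale1r.
    by move=> i z /=; rewrite !mxE.
  have s2 p (M2 : nat -> 'M[S]_(k, p)) (g : 'I_q.+1 * 'I_k -> S) l' : (forall i z, g (i, z) = M2 i z l') ->
      \sum_(w : 'I_q.+1 * 'I_k) u (inl (inr w)) * g w = (r2 *m M2 q) 0 l'.
    move=> gE; rewrite (block_sum (M1 := fun i => (q == i)%:R *: r2) (M2 := M2) (l := 0) (l' := l')) //.
      under eq_bigr do rewrite -scalemxAl.
      by rewrite (sum_delta q.+1 q (fun i => r2 *m M2 i)) ltnSn scale1r.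
    by move=> i z /=; rewrite !mxE /= [z == _]eq_sym.
  case: y => [[[j l]|[j b]]|b].
  - rewrite (s1 _ (gEZ MA ^~ j) _ l) // (s2 _ (gXZ MX ^~ j) _ l) // mulr0 addr0.
    rewrite /gEZ /gXZ eqSS [q.+1 == j]gtn_eqF // scale0r sub0r.
    rewrite mulmxN mul_mx_scalar -scalemxAr r2X.
    by rewrite !mxE addNr.
  - rewrite (s1 _ (gEU MV ^~ j) _ b) // mulr0 addr0.
    rewrite /gEU [q.+1 == j]gtn_eqF // scale0r mulmx0 mxE add0r big1 // => -[? ?] _.
    by rewrite mulr0.
  - rewrite (s1 _ (gET q cm MV) _ b) // big1 => [|[? ?] _]; last by rewrite mulr0.
    rewrite addr0 /gET eqxx scale1r mulN1r /r1 -row_mul mulmx_colsub.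
    by rewrite [row _ _ _ _]mxE [colsub _ _ _ _]mxE subrr.
pose uM : 'rV[S]_#|brow n k q| := \row_i u (enum_val i).
have uM0 : uM *m fmx cardE (bent rho) = 0.
  apply/rowP => j; rewrite mxE [RHS]mxE -[RHS](u0 (enum_val (cast_ord cardE j))).
  rewrite (reindex (fun i : 'I_#|brow n k q| => enum_val i)) /=; last exact/onW_bij/enum_val_bij.
  by apply: eq_bigr => i _; rewrite !mxE.
(* Over a ring, multiplying by the adjugate gives det times [uM] = 0; the entry -1 of [uM] at the
   last row isolates the determinant. *)
have := congr1 (mulmx^~ (\adj (fmx cardE (bent rho)))) uM0.
rewrite /= mul0mx -mulmxA mul_mx_adj mul_mx_scalar => /rowP/(_ (enum_rank (inr ord0))).
by rewrite !mxE enum_rankK /= mulrN1 => /eqP; rewrite oppr_eq0 => /eqP.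
Qed.

Lemma bdet_relation (b0 : 'I_k) :
  \sum_a (MX *m MV) b0 (widen_ord cm a) * bdet (fun b => (b == a)%:R) = 0.
Proof. by rewrite -(bdet_linear (fun a => _)) bdet_pairing. Qed.

End BlockRelation.

(** * A point where a Sylvester minor does not vanish *)

Section Nonvanishing.
Variables (F : numFieldType) (n' m k c' q : nat).
Local Notation n := n'.+1.
Local Notation c := c'.+1.
Variables (cm : (c <= m)%N) (mn : (m < n)%N) (kc : (k <= c')%N).
Hypothesis nE : (n = q.+1 * (m - k) + c')%N.

Let r := (m - k)%N.
(** The nilpotent shift by r = m - k on the chains e_j, e_(j+r), ... for k <= j < m: under [nE], c'
    - k of these have q + 2 vectors and the others q + 1. *)
Definition shift_mx : 'M[F]_n :=
  \matrix_(l, j) (((l : nat) == (j + (m - k))%N) && (k <= j)%N)%:R.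
Local Notation A0 := shift_mx.
Local Notation v0 := (std_v F n' m).
Local Notation xi0 := (std_xi F n' k).

Let mE : m = (k + r)%N. Proof. by rewrite /r subnKC // (leq_trans kc) // ltnW. Qed.

Lemma shift_mul (z : 'cV[F]_n) (l : 'I_n) :
  (A0 *m z) l 0 = if (m <= l)%N then z (inord (l - r)) 0 else 0.
Proof.
have AE (i j : 'I_n) : A0 i j = (((i : nat) == (j + r)%N) && (k <= j)%N)%:R by rewrite mxE.
rewrite mxE; case: leqP => ml; last first.
  rewrite big1 // => j _; rewrite AE; case: andP => [[/eqP lj kj]|]; last by rewrite mul0r.
  by move: ml; rewrite lj mE ltn_add2r ltnNge kj.
have rl : (r <= l)%N by rewrite (leq_trans _ ml) // mE leq_addl.
have lrn : (l - r < n)%N by rewrite (leq_ltn_trans (leq_subr _ _)).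
rewrite (bigD1 (inord (l - r))) //= AE inordK // subnK // eqxx /=.
rewrite leq_subRL // addnC -mE ml mul1r big1 ?addr0 // => j jl.
rewrite AE; case: andP => [[/eqP lj kj]|]; last by rewrite mul0r.
by case/eqP: jl; apply: val_inj; rewrite /= inordK // lj addnK.
Qed.

Lemma std_v_mul p (u : 'cV[F]_p) (pm : (p <= m)%N) (l : 'I_n) :
  (colsub (widen_ord pm) v0 *m u) l 0 = oapp (fun a => u a 0) 0 (insub (l : nat)).
Proof.
rewrite mxE; case: insubP => [a _ al|lp] /=.
  rewrite (bigD1 a) //= !mxE /= al eqxx mul1r big1 ?addr0 // => b ba.
  rewrite !mxE /= -al eq_sym; case: eqP => [/val_inj ab|]; last by rewrite mul0r.
  by rewrite ab eqxx in ba.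
rewrite big1 // => b _; rewrite !mxE /=; case: eqP => [lb|]; last by rewrite mul0r.
by rewrite lb ltn_ord in lp.
Qed.

Lemma std_xi_mul (z : 'cV[F]_n) (kn : (k <= n)%N) (b : 'I_k) :
  (xi0 *m z) b 0 = z (widen_ord kn b) 0.
Proof.
rewrite mxE (bigD1 (widen_ord kn b)) //= mxE eqxx mul1r big1 ?addr0 // => j jb.
rewrite mxE; case: eqP => [bj|]; last by rewrite mul0r.
by case/eqP: jb; apply: val_inj.
Qed.

(** The images of A0 and v0 are spanned by complementary sets of basis vectors, so each equation
    splits. Going up from i = 0 kills the coordinates l >= k of Z_i with l + (i + 1) r < n. Once Z_q
    = 0, going down confines each Z_i to l < m, where those coordinates and xi Z_i = 0 leave
    nothing. *)
Lemma block_kernel (Z : nat -> 'cV[F]_n) (U : nat -> 'cV[F]_m) (T : 'cV[F]_c) :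
  (forall i, (i < q.+2)%N ->
    (i < q.+1)%:R *: (A0 *m Z i) - (0 < i)%:R *: Z i.-1 + (i < q.+1)%:R *: (v0 *m U i) +
    (i == q.+1)%:R *: (colsub (widen_ord cm) v0 *m T) = 0) ->
  (forall i, (i < q.+1)%N -> xi0 *m Z i = 0) ->
  T ord_max 0 = 0 ->
  [/\ forall i, (i < q.+1)%N -> Z i = 0, forall i, (i < q.+1)%N -> U i = 0 & T = 0].
Proof.
move=> EE EX ET.
have kn : (k <= n)%N by apply: ltnW; rewrite (leq_ltn_trans _ mn) // mE leq_addr.
have rn : (r <= m)%N by rewrite mE leq_addl.
have EX' i l : (i < q.+1)%N -> (l < k)%N -> Z i (inord l) 0 = 0.
  move=> iq lk; have := congr1 (fun M : 'cV[F]_k => M (Ordinal lk) 0) (EX i iq).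
  rewrite (std_xi_mul _ kn) !mxE => <-; congr (Z i _ 0).
  by apply: val_inj; rewrite /= inordK // (leq_trans lk).
have v0E (u : 'cV[F]_m) (l : 'I_n) : (v0 *m u) l 0 = oapp (fun a => u a 0) 0 (insub (l : nat)).
  rewrite -(std_v_mul u (leqnn m)); congr ((_ *m u) l 0).
  by apply/matrixP => i j; rewrite !mxE.
have E0 (l : 'I_n) : (if (m <= l)%N then Z 0 (inord (l - r)) 0 else 0) +
    oapp (fun a => U 0 a 0) 0 (insub (l : nat)) = 0.
  have := congr1 (fun M : 'cV[F]_n => M l 0) (EE 0%N isT).
  rewrite scale0r subr0 !scale1r scale0r addr0.
  by rewrite [LHS]mxE shift_mul v0E => ->; rewrite mxE.
have ES i (l : 'I_n) : (i < q)%N -> Z i l 0 =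
    (if (m <= l)%N then Z i.+1 (inord (l - r)) 0 else 0) +
    oapp (fun a => U i.+1 a 0) 0 (insub (l : nat)).
  move=> iq; have i1 : (i.+1 < q.+1)%N by [].
  have := congr1 (fun M : 'cV[F]_n => M l 0) (EE i.+1 (ltnW i1)).
  rewrite i1 ltn_eqF // !scale1r scale0r addr0 -shift_mul -v0E /=.
  move: (A0 *m Z i.+1) (v0 *m U i.+1) => X Y; rewrite !mxE addrAC => /eqP.
  by rewrite subr_eq0 => /eqP.
have EQ (l : 'I_n) : Z q l 0 = oapp (fun a => T a 0) 0 (insub (l : nat)).
  have := congr1 (fun M : 'cV[F]_n => M l 0) (EE q.+1 (ltnSn _)).
  rewrite ltnn eqxx !scale1r !scale0r add0r addr0 -std_v_mul /=.
  move: (colsub _ _ *m T) => X; rewrite !mxE addrC => /eqP.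
  by rewrite subr_eq0 => /eqP.
have mlr l : (m <= l + r)%N = (k <= l)%N by rewrite mE leq_add2r.
have low i l : (i < q.+1)%N -> (k <= l)%N -> (l + i.+1 * r < n)%N -> Z i (inord l) 0 = 0.
  elim: i l => [|i IH] l iq kl ln.
    rewrite mul1n in ln; have := E0 (inord (l + r)); rewrite inordK // addnK.
    by rewrite mlr kl insubF ?addr0 // ltnNge mlr kl.
  have lr : (l + r < n)%N by apply: leq_ltn_trans ln; rewrite leq_add2l mulSn leq_addr.
  have := ES i (inord (l + r)) iq; rewrite inordK // addnK mlr kl insubF.
    rewrite addr0 => <-; apply: IH; [exact: ltnW|by rewrite (leq_trans kl) ?leq_addr|].
    by rewrite -addnA -mulSn.
  by rewrite ltnNge mlr kl.
have bn (b : 'I_c) : (b < n)%N by rewrite (leq_trans (ltn_ord b)) // (leq_trans cm) // ltnW.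
have Tl (b : 'I_c) : T b 0 = Z q (inord b) 0 by rewrite EQ inordK // valK.
(* Z_q = v T is supported on l <= c'. The equation in xi covers l < k, and [low] covers k <= l < c'
   = n - (q + 1) r; the single coordinate c' is left to the added last row. *)
have Zq : Z q = 0.
  apply/colP => l; rewrite [RHS]mxE EQ; case: insubP => [b _ _|//] /=.
  have [bk|kb] := ltnP b k; first by rewrite Tl EX'.
  have [bc|] := ltnP b c'; first by rewrite Tl low // nE -/r addnC ltn_add2l.
  move=> cb; have -> : b = ord_max by apply/val_inj/anti_leq; rewrite /= cb -ltnS ltn_ord.
  exact: ET.
have T0 : T = 0 by apply/colP => b; rewrite [RHS]mxE Tl Zq mxE.
have Z0 i : (i < q.+1)%N -> Z i = 0.
  move=> iq; have [d] : {d | (i + d = q)%N} by exists (q - i)%N; rewrite subnKC.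
  elim: d i iq => [|d IH] i iq; first by rewrite addn0 => ->.
  rewrite addnS -addSn => id.
  have i1 : (i < q)%N by rewrite -id addSn ltnS leq_addr.
  have Zi1 : Z i.+1 = 0 by apply: IH.
  apply/colP => l; rewrite [RHS]mxE.
  have [ml|lm] := leqP m l.
    rewrite ES // ml Zi1 mxE insubF ?addr0 //.
    by apply/negbTE; rewrite -leqNgt.
  have [lk|kl] := ltnP l k; first by rewrite -[l]inord_val EX'.
  have irq : (i.+1 * r <= q * r)%N by rewrite leq_mul2r i1 orbT.
  rewrite -[l]inord_val low //; apply: (leq_trans _ (eq_leq (esym nE))).
  rewrite -/r [(q.+1 * r)%N]mulSn; move: (i.+1 * r)%N (q * r)%N irq lm kc; rewrite mE => x y.
  move: (nat_of_ord l) => l'; lia.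
have U0 i : (i < q.+1)%N -> U i = 0.
  move=> iq; apply/colP => b; rewrite [RHS]mxE.
  have bn' : (b < n)%N by rewrite (leq_trans (ltn_ord b)) // ltnW.
  have bm : (m <= b)%N = false by rewrite leqNgt ltn_ord.
  have ub (u : 'cV[F]_m) : oapp (fun a => u a 0) 0 (insub (b : nat)) = u b 0.
    by rewrite valK.
  case: i iq => [|i] iq.
    by have := E0 (Ordinal bn'); rewrite /= bm ub add0r.
  have := ES i (Ordinal bn') iq; rewrite /= bm ub add0r => <-.
  by rewrite Z0 ?mxE // ltnW.
by split.
Qed.

Hypothesis cardE : #|brow n k q| = #|bcol n m c q|.

Lemma bdet_neq0 :
  \det (fmx cardE (bent cm A0 v0 xi0 (fun b => (b == ord_max)%:R))) != 0.
Proof.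
set G := bent _ _ _ _ _; rewrite -det_tr; apply/det0P => -[u un0 uG].
pose U (y : bcol n m c q) := u 0 (cast_ord (esym cardE) (enum_rank y)).
have GU x : \sum_y G x y * U y = 0.
  have := congr1 (fun M : 'rV[F]_#|brow n k q| => M 0 (enum_rank x)) uG.
  rewrite !mxE => h; rewrite -[RHS]h.
  rewrite (reindex (fun i : 'I_#|bcol n m c q| => enum_val i)) /=; last exact/onW_bij/enum_val_bij.
  rewrite (reindex (cast_ord cardE)) /=; last first.
    by apply: onW_bij; exists (cast_ord (esym cardE)) => i; rewrite ?cast_ordK ?cast_ordKV.
  apply: eq_bigr => i _; rewrite !mxE enum_rankK mulrC; congr (u _ _ * _).
  by rewrite enum_valK cast_ordK.
pose zc (j : nat) : 'cV[F]_n := \col_l U (inl (inl (inord j, l))).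
pose uc (j : nat) : 'cV[F]_m := \col_l U (inl (inr (inord j, l))).
pose tc : 'cV[F]_c := \col_l U (inr l).
have Zs p (M1 : nat -> 'M[F]_(p, n)) (l : 'I_p) (f : 'I_q.+1 * 'I_n -> F) :
    (forall i z, f (i, z) = M1 i l z) ->
    \sum_w f w * U (inl (inl w)) = (\sum_(i < q.+1) M1 i *m zc i) l 0.
  by move=> fE; apply: block_sum => // i z; rewrite mxE inord_val.
have Us p (M1 : nat -> 'M[F]_(p, m)) (l : 'I_p) (f : 'I_q.+1 * 'I_m -> F) :
    (forall i z, f (i, z) = M1 i l z) ->
    \sum_w f w * U (inl (inr w)) = (\sum_(i < q.+1) M1 i *m uc i) l 0.
  by move=> fE; apply: block_sum => // i z; rewrite mxE inord_val.
have [||| Z0 U0 T0] := @block_kernel zc uc tc.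
- move=> i iq; apply/colP => l; rewrite [RHS]mxE.
  rewrite -[RHS](GU (inl (inl (Ordinal iq, l)))) !big_sumType /G /=.
  rewrite (Zs n (gEZ A0 i) l) // (Us n (gEU v0 i) l) //.
  have -> : \sum_(b : 'I_c) gET q cm v0 i l b * U (inr b) = (gET q cm v0 i *m tc) l 0.
    by rewrite mxE; apply: eq_bigr => b _; rewrite [tc _ _]mxE.
  have -> : \sum_(j < q.+1) gEZ A0 i j *m zc j =
      (i < q.+1)%:R *: (A0 *m zc i) - (0 < i)%:R *: zc i.-1.
    under eq_bigr do rewrite mulmxBl -scalemxAl mul_scalar_mx.
    rewrite sumrB (sum_delta q.+1 i (fun j => A0 *m zc j)) (sum_deltaS q.+1 i zc).
    by rewrite [(i <= q.+1)%N]iq andbT.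
  have -> : \sum_(j < q.+1) gEU v0 i j *m uc j = (i < q.+1)%:R *: (v0 *m uc i).
    under eq_bigr do rewrite -scalemxAl.
    by rewrite (sum_delta q.+1 i (fun j => v0 *m uc j)).
  by rewrite /gET -scalemxAl [LHS]mxE; congr (_ + _); rewrite [LHS]mxE.
- move=> i iq; apply/colP => b; rewrite [RHS]mxE.
  rewrite -[RHS](GU (inl (inr (Ordinal iq, b)))) !big_sumType /G /=.
  rewrite (Zs k (gXZ xi0 i) b) // [X in _ + X + _]big1 => [|[? ?] _]; last by rewrite mul0r.
  rewrite addr0 [X in _ + X]big1 => [|? _]; last by rewrite mul0r.
  rewrite addr0; under eq_bigr do rewrite -scalemxAl.
  by rewrite (sum_delta q.+1 i (fun j => xi0 *m zc j)) iq scale1r.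
- rewrite mxE -[RHS](GU (inr ord0)) !big_sumType /G /=.
  rewrite big1 => [|[? ?] _]; last by rewrite mul0r.
  rewrite add0r big1 => [|[? ?] _]; last by rewrite mul0r.
  rewrite add0r (bigD1 ord_max) //= eqxx mul1r big1 ?addr0 // => b bm.
  by rewrite (negPf bm) mul0r.
case/eqP: un0; apply/rowP => i; rewrite mxE.
have -> : u 0 i = U (enum_val (cast_ord cardE i)) by rewrite /U enum_valK cast_ordK.
case: (enum_val _) => [[[j l]|[j l]]|b].
- by have := Z0 j (ltn_ord j); move/colP/(_ l); rewrite !mxE inord_val.
- by have := U0 j (ltn_ord j); move/colP/(_ l); rewrite !mxE inord_val.
- by move/colP/(_ b): T0; rewrite !mxE.
Qed.

End Nonvanishing.

(** * Invariance and weights of the minors and of the pairings *)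

Section Minors.
Variables (F : numFieldType) (n' m k c' q : nat).
Local Notation n := n'.+1.
Local Notation c := c'.+1.
Local Notation N := (qdim n m k).
Local Notation lst := (ord_max : 'I_n).
Local Notation iwt := (@iweight n' m k).
Local Notation MV := (Mv F n' m k).
Local Notation MX := (Mx F n' m k).
Variables (cm : (c <= m)%N) (mn : (m < n)%N) (kc : (k <= c')%N).
Hypothesis cardE : #|brow n k q| = #|bcol n m c q|.

(* S(q) only sees A modulo scalars; this representative has last diagonal entry 0. *)
Definition Ma : 'M[{mpoly F[N]}]_n :=
  \matrix_(i, j) oapp (fun u => qvar F (inl (inl u))) 0 (insub (j, i)).
Local Notation MA := Ma.

Lemma meval_Ma p : map_mx (meval (ptc p)) MA = p.1.1 - (p.1.1 lst lst)%:M.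
Proof.
apply/matrixP => i j; rewrite !mxE; case: insubP => [u hu uE|] /=.
  rewrite mevalXU /ptc enum_rankK pairing_sl uE /= eq_sym.
  by case: (i == j); rewrite ?mul1r ?mul0r.
rewrite meval0 /notlast /= negbK => /andP[jl il].
have -> : i = lst by apply: val_inj; apply/eqP.
have -> : j = lst by apply: val_inj; apply/eqP.
by rewrite eqxx mulr1n subrr.
Qed.

Local Notation cmx := (map_mx (@mpolyC N F)).

Lemma meval_constmx p p1 p2 (M : 'M[F]_(p1, p2)) : map_mx (meval (ptc p)) (cmx M) = M.
Proof. by apply/matrixP => i j; rewrite !mxE mevalC. Qed.

Lemma mpoly_ptc0 (f : {mpoly F[N]}) : (forall p : qpt F n' m k, f.@[ptc p] = 0) -> f = 0.
Proof.
by move=> f0; apply: mpoly_fun0 => v; have [p [_ /meval_eq <-]] := ptc_surj v.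
Qed.

Lemma mpoly_ptc_eq (f g : {mpoly F[N]}) :
  (forall p : qpt F n' m k, f.@[ptc p] = g.@[ptc p]) -> f = g.
Proof.
move=> fg; apply/eqP; rewrite -subr_eq0; apply/eqP/mpoly_ptc0 => p.
by rewrite mevalB fg subrr.
Qed.

Lemma adS_qvar x (t : qidx n m k) : adS x (qvar F t) = qlin (qbr x (qbasis F t)) :> {mpoly F[N]}.
Proof. by rewrite adSE vfieldX /adv enum_rankK. Qed.

Lemma meval_adS_qvar x (t : qidx n m k) p : (adS x (qvar F t)).@[ptc p] = pairing (coact x p) (qbasis F t).
Proof. by rewrite adS_qvar (meval_qlin _ (in_q_qbr _ _)) pairing_qbr. Qed.

Lemma map_mx_eval p1 p2 (M1 M2 : 'M[{mpoly F[N]}]_(p1, p2)) :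
  (forall p : qpt F n' m k, map_mx (meval (ptc p)) M1 = map_mx (meval (ptc p)) M2) -> M1 = M2.
Proof.
move=> M12; apply/matrixP => i j; apply: mpoly_ptc_eq => p.
by have /matrixP/(_ i j) := M12 p; rewrite !mxE.
Qed.

Lemma adS_MV a e w : map_mx (adS (a, e, w)) MV = - ((cmx a) *m MV).
Proof.
apply: map_mx_eval => p; rewrite map_mxN map_mxM meval_constmx meval_Mv.
apply/matrixP => j b; rewrite mxE [map_mx _ _ _ _]mxE [MV _ _]mxE meval_adS_qvar.
by rewrite pairing_covec.
Qed.

Lemma adS_MX a e w : map_mx (adS (a, e, w)) MX = MX *m (cmx a).
Proof.
apply: map_mx_eval => p; rewrite map_mxM meval_constmx meval_Mx.
apply/matrixP => j b; rewrite mxE [map_mx _ _ _ _]mxE [MX _ _]mxE meval_adS_qvar.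
by rewrite pairing_vec.
Qed.

(** [Ma] keeps its last diagonal entry zero, so it follows the action on A only up to a scalar: ka,
    a polynomial, is minus the last diagonal entry of the expected derivative. *)
Lemma adS_MA a e w : exists ka, map_mx (adS (a, e, w)) MA =
  MA *m (cmx a) - (cmx a) *m MA + MV *m (cmx e) - (cmx w) *m MX + ka%:M.
Proof.
pose M := MA *m (cmx a) - (cmx a) *m MA + MV *m (cmx e) - (cmx w) *m MX.
exists (- M lst lst); apply: map_mx_eval => p.
have ME : map_mx (meval (ptc p)) M = (coact (a, e, w) p).1.1.
  rewrite /M !(map_mxB, map_mxD, map_mxM) !meval_constmx meval_Ma meval_Mv meval_Mx /=.
  congr (_ + _ - _).
  by rewrite mulmxBl mulmxBr scalar_mxC opprB addrA subrK.
rewrite -/M map_mxD ME map_scalar_mx raddfN /=.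
have -> : (M lst lst).@[ptc p] = (coact (a, e, w) p).1.1 lst lst.
  by rewrite -ME [RHS]mxE.
apply/matrixP => i j; rewrite mxE [map_mx _ _ _ _]mxE [MA _ _]mxE.
case: insubP => [u hu uE|].
  rewrite meval_adS_qvar pairing_sl uE [(_, _).2]/= [(_, _).1]/= [RHS]mxE; congr (_ + _).
  rewrite [RHS]mxE eq_sym; case: (i == j); rewrite ?mul1r ?mul0r ?mulr1n ?mulr0n ?oppr0 //.
rewrite raddf0 meval0 /notlast /= negbK => /andP[jl il].
have -> : i = lst by apply: val_inj; apply/eqP.
have -> : j = lst by apply: val_inj; apply/eqP.
by rewrite [RHS]mxE [(_%:M) _ _]mxE eqxx mulr1n subrr.
Qed.

(** With a unit vector as last row, the determinant is up to sign the maximal minor that omits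
    column [b] of the last block. *)
Definition minor (b : 'I_c) : {mpoly F[N]} :=
  \det (fmx cardE (bent cm MA MV MX (fun d => (d == b)%:R))).

Lemma minor_invariant b : q_invariant (minor b).
Proof.
move=> [[a e] w] aq; have [ka DA] := adS_MA a e w.
pose D : {additive {mpoly F[N]} -> {mpoly F[N]}} := adS (a, e, w).
have DM P Q : D (P * Q) = D P * Q + P * D Q by rewrite /D /= !adSE vfieldM.
apply: (derivation_bdet (D := D) cm DM DA (adS_MV a e w) (adS_MX a e w)) => [d|].
- by case: (d == b); rewrite /D /= adSE -?mpolyC0 -?mpolyC1 vfieldC.
- by rewrite trace_map_mx [\tr a]aq raddf0.
Qed.

(** The last row is constant in columns of weight [wunit None], whence the compensating sign. *)
Definition rweight (x : brow n k q) : qweight k :=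
  match x with
  | inl (inl _) => 0
  | inl (inr (_, b)) => wunit (Some b)
  | inr _ => - wunit None
  end.

Definition cweight (y : bcol n m c q) : qweight k :=
  match y with
  | inl (inl _) => 0
  | _ => wunit None
  end.

Definition minor_weight : qweight k := \sum_x rweight x + \sum_y cweight y.

Lemma whom_bent b x y : whom iwt (rweight x + cweight y)
  (bent cm MA MV MX (fun d => (d == b)%:R) x y).
Proof.
have hV j a : whom iwt (wunit None) (MV j a).
  rewrite mxE; have := @whomXU F N _ iwt (enum_rank (inl (inr (a, j)) : qidx n m k)).
  by rewrite /iweight enum_rankK.
have hX b' j : whom iwt (wunit (Some b')) (MX b' j).
  rewrite mxE; have := @whomXU F N _ iwt (enum_rank (inr (j, b') : qidx n m k)).
  by rewrite /iweight enum_rankK.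
have hA i j : whom iwt 0 (MA i j).
  rewrite mxE; case: insubP => [u _ _|_]; last exact: whom0.
  have := @whomXU F N _ iwt (enum_rank (inl (inl u) : qidx n m k)).
  by rewrite /iweight enum_rankK.
have hC (d : bool) w (f : {mpoly F[N]}) : whom iwt w f -> whom iwt w (d%:R * f).
  by case: d => hf; rewrite ?mul1r // mul0r; apply: whom0.
have h1 (d : bool) : whom iwt 0 (d%:R : {mpoly F[N]}).
  by case: d; [rewrite -mpolyC1; apply: whomC | apply: whom0].
case: x => [[[i l]|[i b']]|z]; case: y => [[[j l']|[j a]]|a] /=; rewrite ?addr0 ?add0r.
- have -> : gEZ MA i j l l' = (i == j :> nat)%:R * MA l l' - (i == j.+1 :> nat)%:R *+ (l == l').
    by rewrite !mxE.
  apply: whomD; first exact/hC/hA.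
  by apply: whomN; case: (l == l'); rewrite /= ?mulr1n ?mulr0n; [apply: h1 | apply: whom0].
- by rewrite /gEU mxE; apply/hC/hV.
- by rewrite /gET mxE [colsub _ _ _ _]mxE; apply/hC/hV.
- by rewrite /gXZ mxE; apply/hC/hX.
- exact: whom0.
- exact: whom0.
- exact: whom0.
- exact: whom0.
- by rewrite addNr; apply: h1.
Qed.

Lemma whom_minor b : whom iwt minor_weight (minor b).
Proof. by apply: whom_fdet => x y; apply: whom_bent. Qed.

Lemma minor_weight_vec b : minor_weight (Some b) = q.+1.
Proof.
rewrite /minor_weight ffunE !sum_ffunE !big_sumType /=.
rewrite [X in X + _ + _]big1 => [|[? ?] _]; last by rewrite ffunE.
rewrite [X in _ + (X + _ + _)]big1 => [|[? ?] _]; last by rewrite ffunE.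
rewrite [X in _ + (_ + X + _)]big1 => [|[? ?] _]; last by rewrite ffunE.
rewrite [X in _ + (_ + X)]big1 => [|? _]; last by rewrite ffunE.
rewrite big_ord1 !ffunE oppr0 !addr0 add0r.
rewrite (eq_bigr (fun u : 'I_q.+1 * 'I_k => (u.2 == b)%:Z)) => [|[i b'] _]; last first.
  by rewrite ffunE (inj_eq Some_inj) eq_sym.
rewrite -(pair_bigA _ (fun (i : 'I_q.+1) b' => (b' == b)%:Z)) /=.
rewrite (eq_bigr (fun=> 1)) ?sumr_const ?card_ord ?natz // => i _.
by rewrite (bigD1 b) //= eqxx big1 ?addr0 // => b' /negPf->.
Qed.

(** The degree in v counts the columns in u, less one for the last row: (q + 1) m + c'. Squareness
    of the matrix makes this n + (q + 1) k. *)
Lemma wdef_minor_weight : wdef minor_weight = n.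
Proof.
rewrite /wdef (eq_bigr _ (fun b _ => minor_weight_vec b)) sumr_const card_ord.
have -> : minor_weight None = (q.+1 * m + c')%N%:Z.
  rewrite /minor_weight ffunE !sum_ffunE !big_sumType /=.
  rewrite [X in X + _ + _]big1 => [|[? ?] _]; last by rewrite ffunE.
  rewrite [X in _ + X + _]big1 => [|[? ?] _]; last by rewrite ffunE.
  rewrite [X in _ + (X + _ + _)]big1 => [|[? ?] _]; last by rewrite ffunE.
  rewrite [X in _ + (_ + X + _)](eq_bigr (fun=> 1)) => [|[? ?] _]; last by rewrite ffunE eqxx.
  rewrite [X in _ + (_ + _ + X)](eq_bigr (fun=> 1)) => [|? _]; last by rewrite ffunE eqxx.
  rewrite big_ord1 !ffunE eqxx !sumr_const card_prod !card_ord !natz /=.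
  lia.
move: cardE; rewrite /brow /bcol !card_sum !card_prod !card_ord.
rewrite -mulr_natr natz -PoszM => h; apply/eqP; rewrite subr_eq -PoszD eqz_nat; apply/eqP.
by move: h; nia.
Qed.

Lemma meval_minor p b : (minor b).@[ptc p] =
  \det (fmx cardE (bent cm (p.1.1 - (p.1.1 lst lst)%:M) p.1.2 p.2 (fun d => (d == b)%:R))).
Proof.
rewrite /minor -det_map_mx; congr (\det _); apply/matrixP => i j; rewrite !mxE.
rewrite -meval_Ma -meval_Mv -meval_Mx.
have hb (d : bool) : (d%:R : {mpoly F[N]}).@[ptc p] = d%:R.
  by case: d; rewrite ?meval1 ?meval0.
case: (enum_val i) => [[[i' l]|[i' b']]|z]; case: (enum_val _) => [[[j' l']|[j' a]]|a] /=;
  rewrite ?meval0 ?hb //.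
- by rewrite /gEZ !mxE mevalB mevalM hb mevalMn hb.
- by rewrite /gEU !mxE mevalM hb.
- by rewrite /gET !mxE mevalM hb.
- by rewrite /gXZ !mxE mevalM hb.
Qed.

Lemma minor_neq0 : (k < m)%N -> n = (q.+1 * (m - k) + c')%N -> minor ord_max != 0.
Proof.
move=> km nE; have := bdet_neq0 F cm mn kc nE cardE.
apply: contraNneq => m0.
have := congr1 (meval (ptc (shift_mx F n' m k, std_v F n' m, std_xi F n' k))) m0.
rewrite meval0 meval_minor /= => H; apply/eqP; rewrite -[RHS]H.
have -> : shift_mx F n' m k lst lst = 0.
  by rewrite mxE; case: eqP => //= h; move: h km; lia.
by rewrite raddf0 subr0.
Qed.

Definition ypair (b : 'I_k) (a : 'I_c) : {mpoly F[N]} := (MX *m MV) b (widen_ord cm a).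

Lemma ypair_invariant b a : q_invariant (ypair b a).
Proof.
move=> [[x e] w] xq; rewrite /ypair mxE raddf_sum /=.
transitivity ((map_mx (adS (x, e, w)) MX *m MV +
    MX *m map_mx (adS (x, e, w)) MV) b (widen_ord cm a)).
  by rewrite !mxE -big_split; apply: eq_bigr => l _ /=; rewrite !mxE adSE vfieldM -!adSE.
by rewrite adS_MV adS_MX mulmxN mulmxA subrr mxE.
Qed.

Lemma whom_ypair b a : whom iwt (wunit None + wunit (Some b)) (ypair b a).
Proof.
rewrite /ypair mxE; apply: whom_sum => l _; rewrite addrC; apply: whomM; rewrite mxE.
  have := @whomXU F N _ iwt (enum_rank (inr (l, b) : qidx n m k)).
  by rewrite /iweight enum_rankK.
have := @whomXU F N _ iwt (enum_rank (inl (inr (widen_ord cm a, l)) : qidx n m k)).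
by rewrite /iweight enum_rankK.
Qed.

Lemma ypair_free b (a : 'I_c -> F) : \sum_j a j *: ypair b j = 0 -> forall j, a j = 0.
Proof.
move=> ay j; have jn : (j < n)%N by rewrite (leq_trans (ltn_ord j)) // (leq_trans cm) // ltnW.
(* At this point [ypair b i] is 1 for i = j and 0 otherwise. *)
pose p : qpt F n' m k := (0, std_v F n' m, delta_mx b (Ordinal jn)).
have := congr1 (meval (ptc p)) ay; rewrite meval0 raddf_sum /= => H; rewrite -[RHS]H.
have yE i : (ypair b i).@[ptc p] = (i == j)%:R.
  transitivity ((p.2 *m p.1.2) b (widen_ord cm i)).
    by rewrite -meval_Mx -meval_Mv -map_mxM mxE.
  rewrite /p /= -[delta_mx b _](@mul_delta_mx _ _ 1 _ 0) -mulmxA -rowE mxE big_ord1 !mxE eqxx mul1r.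
  by rewrite /= eq_sym.
rewrite (bigD1 j) //= mevalZ yE eqxx mulr1 big1 ?addr0 // => i ij.
by rewrite mevalZ yE (negPf ij) mulr0.
Qed.

End Minors.

(** * Weight components of m^2 and the conclusion *)

Lemma whom_coef0 (F : numFieldType) N (W : zmodType) (cl : 'I_N -> W) w (P : {mpoly F[N]}) :
  whom cl w P -> w != 0 -> P@_0 = 0.
Proof.
move=> Pw wn0; apply/eqP; apply: contraT => /Pw; rewrite mwt0 => w0.
by rewrite -w0 eqxx in wn0.
Qed.

(** The factors in m^2 need not be homogeneous. Their weight components are still invariants without
    constant term, and the part of a product in weight w pairs components whose weights add up to
    w. *)
Lemma wcomp_aug_square (F : numFieldType) (n' m k : nat) (w : qweight k)
    (f : {mpoly F[qdim n'.+1 m k]}) :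
  (forall (P Q : {mpoly F[qdim n'.+1 m k]}) (a a' : qweight k), q_invariant P -> q_invariant Q ->
     whom (@iweight n' m k) a P -> whom (@iweight n' m k) a' Q ->
     P@_0 = 0 -> Q@_0 = 0 -> a + a' = w -> P * Q = 0) ->
  aug_square (@q_invariant F n'.+1 m k) f -> wcomp (@iweight n' m k) w f = 0.
Proof.
move=> PQ0 [s [sA ->]]; rewrite raddf_sum big1_seq //= => u /sA [u1 u2 u10 u20].
rewrite wcompM big1 // => a _; apply: (PQ0 _ _ a (w - a)).
- exact: wcomp_invariant.
- exact: wcomp_invariant.
- exact: whom_comp.
- exact: whom_comp.
- by rewrite mcoeff_wcomp u10 if_same.
- by rewrite mcoeff_wcomp u20 if_same.
- by rewrite addrC subrK.
Qed.

Lemma invariants_not_polynomial (F : numFieldType) (n m k : nat) :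
  (0 < k)%N -> (k < m)%N -> (m < n)%N -> ~~ ((m - k) %| (n - m))%N ->
  ~ is_polynomial_ring (@q_invariant F n m k).
Proof.
case: n => [|n'] // k0 km mn ndvd Apoly.
pose r := (m - k)%N; pose q := ((n'.+1 - m) %/ r)%N; pose s := ((n'.+1 - m) %% r)%N.
have r0 : (0 < r)%N by rewrite subn_gt0.
have dE : (n'.+1 - m = q * r + s)%N by apply: divn_eq.
have s0 : (0 < s)%N by rewrite lt0n; apply: contra ndvd.
have sr : (s < r)%N by rewrite ltn_mod.
have cm : (k + s < m)%N by move: sr; rewrite /r; lia.
have kc : (k <= k + s)%N by rewrite leq_addr.
have nE : n'.+1 = (q.+1 * r + (k + s))%N by rewrite mulSn; move: dE km mn; rewrite /r; lia.
have cardE : #|brow n'.+1 k q| = #|bcol n'.+1 m (k + s).+1 q|.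
  rewrite !card_sum !card_prod !card_ord.
  have mE : m = (k + r)%N by rewrite /r subnKC // ltnW.
  move: nE mE; move: (r) (q) => x z; move: (n'.+1) => nn -> ->; nia.
pose b0 : 'I_k := Ordinal k0.
pose y := @ypair F n' m k _ cm b0.
pose f := @minor F n' m k _ q cm cardE.
pose wf := @minor_weight n' m k (k + s) q.
pose wy : qweight k := wunit None + wunit (Some b0).
have wfE : wdef wf = n'.+1 by apply: wdef_minor_weight.
have wyE : wdef wy = 0.
  rewrite /wdef (bigD1 b0) //= !ffunE eqxx big1 => [|b bb]; first by rewrite /= ?(addr0, add0r) subrr.
  by rewrite !ffunE (inj_eq Some_inj) (negPf bb).
have wn (w : qweight k) : w (Some b0) != 0 -> w != 0 by apply: contraNneq => ->; rewrite ffunE.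
(* The index [ord_max] is the one whose minor is known to be nonzero. *)
have [||| a [b [ab sq]]] := @polynomial_ring_relation F _ _ _ y f ord_max
    (@q_invariant_closed F n' m k) Apoly.
- move=> j; split; first exact: ypair_invariant.
  apply: (whom_coef0 (@whom_ypair F n' m k _ cm b0 j)); apply: wn.
  by rewrite !ffunE eqxx.
- move=> j; split; first exact: minor_invariant.
  by apply: (whom_coef0 (@whom_minor F n' m k _ q cm cardE j)); apply: wn; rewrite minor_weight_vec.
- exact: bdet_relation.
(* The two parts of the combination have different weights, with [wdef] equal to 0 and n, so each of
   them has to vanish by itself. *)
have yw : whom (@iweight n' m k) wy (\sum_j a j *: y j).
  by apply: whom_sum => j _; apply/whomZ/whom_ypair.
have fw : whom (@iweight n' m k) wf (b *: f ord_max) by apply/whomZ/whom_minor.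
have wyf : wy != wf.
  by apply/eqP => /(congr1 (@wdef k)); rewrite wyE wfE.
have ya0 : \sum_j a j *: y j = 0.
  have := wcomp_aug_square (w := wy) _ sq.
  rewrite raddfD /= (wcomp_whom _ yw) (wcomp_whom _ fw) eqxx eq_sym (negPf wyf) addr0; apply.
  move=> P Q c c' Pinv Qinv Pc Qc P0 Q0; apply: product_pairing_eq0 Pinv Qinv Pc Qc P0 Q0.
  by apply: leq_ltn_trans mn; apply: leq_ltn_trans km.
have bf0 : b *: f ord_max = 0.
  have := wcomp_aug_square (w := wf) _ sq.
  rewrite raddfD /= (wcomp_whom _ yw) (wcomp_whom _ fw) eqxx (negPf wyf) add0r; apply.
  move=> P Q c c' Pinv Qinv Pc Qc P0 Q0 cc.
  apply: (product_eq0 (e := q) b0 (ltnW km) (ltnW mn) _ Pinv Qinv Pc Qc P0 Q0 cc wfE) => [|d].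
    (* Here s > 0 gives the strict inequality r q < n - m. *)
    by rewrite dE -/r [(r * q)%N]mulnC -[X in (X < _)%N]addn0 ltn_add2l.
  exact: minor_weight_vec.
have a0 := ypair_free mn ya0.
case: ab => [bn0|[j]]; last by rewrite a0 eqxx.
move/eqP: bf0; rewrite scaler_eq0 (negPf bn0) /=; apply/negP.
exact: minor_neq0.
Qed.

Unset Implicit Arguments.

(* C = complex R for any realType R (e.g. Stdlib's R): the complex numbers. *)
Theorem theorem4p7 (R : realType) (n m k : nat) :
  (0 < k)%N -> (k < m)%N -> (m < n)%N -> ~~ ((m - k) %| (n - m))%N ->
  ~ is_polynomial_ring (@q_invariant (complex R) n m k).
Proof. exact: invariants_not_polynomial. Qed.
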